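(* Let $1\le k\le n-1$. Given a function $u(t)$, $t>0$, set $$v(s)=c\,s^{(k-2)/2}\int_{s/2}^\infty u(t)\,(t-s/2)^{(k-2)/2}\,\frac{dt}{t^{k-1}},\quad s>0,\qquad c=\frac{2^{(k-2)/2}\sigma_{k-1}}{\sigma_k}.$$ Then $$\int_{\mathbb R^n_+\times G_k(\mathbb R^{n-1})}(Jf)(x,\xi)\,u(x_n)\,dx\,d_*\xi=\int_{\mathbb R^n_+}f(x)\,v(x_n)\,dx,$$ provided that either side of this equality exists in the Lebesgue sense.
   Context: $\mathbb R^n_+=\{x=(x',x_n):x'\in\mathbb R^{n-1},x_n>0\}$, $f$ is a function on $\mathbb R^n_+$, $e_n=(0,\dots,0,1)$; $G_k(\mathbb R^{n-1})$ is the Grassmannian of $k$-dimensional linear subspaces of $\mathbb R^{n-1}$ and $d_*\xi$ its $O(n-1)$-invariant probability measure; $dx$ is Lebesgue measure. $\sigma_{m}=2\pi^{(m+1)/2}/\Gamma((m+1)/2)$ is the area of $\mathbb S^m$ ($\sigma_0=2$). For $x\in\mathbb R^n_+$, $\xi\in G_k(\mathbb R^{n-1})$, $$(Jf)(x,\xi)=\frac1{\sigma_k}\int_{\mathbb S^k_\xi}f(x+x_n\theta)\,d\theta,\qquad \mathbb S^k_\xi=\mathbb S^{n-1}\cap(\xi\oplus\mathbb R e_n),$$ with $d\theta$ the surface area measure.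
   Formalization: ''Either side exists in the Lebesgue sense'' is taken for the full multiple integral (over x, ξ, θ, or over x, t): the positive or the negative part of f·u has finite integral. Mere integrability of f(x)v(x_n) is not enough when u changes sign. Functions are real and measurable. *)

(* Defs.v *)
From HB Require Import structures.
From mathcomp Require Import all_boot all_order all_algebra.
From mathcomp Require Import all_classical all_reals all_analysis.

Set Implicit Arguments.
Unset Strict Implicit.
Unset Printing Implicit Defensive.

Import Order.TTheory GRing.Theory Num.Theory.
Import numFieldNormedType.Exports.

Local Open Scope classical_set_scope.
Local Open Scope ring_scope.

(* The sigma-algebra on matrices generated by the entries, as for tuples. *)
Section measurable_matrix.
Context (R : realType) (p q : nat).

Definition mx_entry_sets : set (set 'M[R]_(p, q)) :=
  \bigcup_(ij in [set: 'I_p * 'I_q])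
    preimage_set_system setT (fun M : 'M[R]_(p, q) => M ij.1 ij.2) measurable.

HB.instance Definition _ := @isMeasurable.Build (sigma_display mx_entry_sets)
  'M[R]_(p, q) <<s mx_entry_sets >> (@sigma_algebra0 _ setT mx_entry_sets)
  (@sigma_algebraC _ mx_entry_sets) (@sigma_algebra_bigcup _ setT mx_entry_sets).

End measurable_matrix.

(* R^n is rendered as R^(n-1) * R, following x = (x', x_n). *)
Section euclidean.
Context {R : realType}.

Notation mu1 := (@lebesgue_measure R).

(* Lebesgue measure on R^m. *)
Fixpoint lebesgue_rV (m : nat) : set 'rV[R]_m -> \bar R :=
  match m return set 'rV[R]_m -> \bar R with
  | 0 => \d_(0 : 'rV[R]_0)
  | m'.+1 => pushforward (mu1 \x lebesgue_rV (m := m'))%E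
      (fun p : R * 'rV[R]_m' => row_mx p.1%:M p.2 : 'rV[R]_(1 + m'))
  end.

(* Lebesgue measure on R^(m+1) = R^m * R. *)
Definition lebesgue_rVR (m : nat) : set ('rV[R]_m * R) -> \bar R :=
  (@lebesgue_rV m \x mu1)%E.

Definition half_space (m : nat) : set ('rV[R]_m * R) := [set x | 0 < x.2].

Definition enorm (m : nat) (x : 'rV[R]_m * R) : R :=
  Num.sqrt ((\sum_i x.1 0 i ^+ 2) + x.2 ^+ 2).

(* Measurability with respect to the completion of mu. *)
Definition lebesgue_measurable_fun d (T : measurableType d)
    (mu : set T -> \bar R) (D : set T) (f : T -> R) : Prop :=
  exists2 g : T -> R, measurable_fun D g &
    mu.-negligible [set x | D x /\ f x <> g x].

Definition Gamma (a : R) : R :=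
  \int[mu1]_(t in `]0, +oo[) (t `^ (a - 1) * expR (- t)).

Definition sphere_area (m : nat) : R :=
  2 * pi `^ (m.+1%:R / 2) / Gamma (m.+1%:R / 2).

(* The surface area measure on the unit sphere S^k of R^(k+1) = R^k * R, in the
   polar-coordinate form: the area of A is (k+1) times the volume of the cone
   { r a : a in A, 0 < r <= 1 }. *)
Definition sphere_measure (k : nat) (A : set ('rV[R]_k * R)) : \bar R :=
  (k.+1%:R%:E * @lebesgue_rVR k [set y : 'rV[R]_k * R | (0 < enorm y <= 1)%R /\
     A ((enorm y)^-1 *: y.1, (enorm y)^-1 * y.2)%R])%E.

End euclidean.

Arguments lebesgue_rV {R} m.
Arguments lebesgue_rVR {R} m.
Arguments half_space {R} m.
Arguments sphere_measure {R} k.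

(* All linear subspaces of R^m; G_k(R^m) is the subset of those of dimension k.
   A subspace is identified with its orthogonal projection, which carries the
   topology of each G_k(R^m) and hence its Borel sets. *)
Section subspaces.
Context (R : realType) (m : nat).

Definition lin_subspace : Type := {vspace 'rV[R]_m}.

HB.instance Definition _ := Choice.on lin_subspace.
HB.instance Definition _ := isPointed.Build lin_subspace (0%VS : {vspace 'rV[R]_m}).

Implicit Types xi : {vspace 'rV[R]_m}.

Definition oproj (xi : lin_subspace) : 'M[R]_m :=
  xget 0 [set P : 'M[R]_m | [/\ P^T = P, P *m P = P &
                              forall y : 'rV_m, (y \in xi) = (y *m P == y)]].

Definition subspace_measurable : set (set lin_subspace) :=
  preimage_set_system setT oproj measurable.

Let subspace_measurable_sigma_algebra : sigma_algebra setT subspace_measurable.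
Proof. exact/sigma_algebra_preimage/sigma_algebra_measurable. Qed.

Let subspace_measurable0 : subspace_measurable set0.
Proof. by case: subspace_measurable_sigma_algebra. Qed.

Let subspace_measurableC A : subspace_measurable A -> subspace_measurable (~` A).
Proof.
by case: subspace_measurable_sigma_algebra => _ + _ mA => /(_ _ mA); rewrite setTD.
Qed.

Let subspace_measurable_bigcup (F : (set lin_subspace)^nat) :
  (forall i, subspace_measurable (F i)) -> subspace_measurable (\bigcup_i F i).
Proof. by case: subspace_measurable_sigma_algebra => _ _; apply. Qed.

HB.instance Definition _ := @isMeasurable.Build default_measure_display
  lin_subspace subspace_measurable subspace_measurable0 subspace_measurableC
  subspace_measurable_bigcup.

Definition grassmannian (k : nat) : set lin_subspace :=
  [set xi : lin_subspace | \dim (xi : {vspace 'rV[R]_m}) = k].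

Definition subspace_act (O : 'M[R]_m) (xi : lin_subspace) : lin_subspace :=
  (linfun (mulmxr O : 'rV[R]_m -> 'rV[R]_m) @: (xi : {vspace 'rV[R]_m}))%VS.

(* The O(m)-invariant probability measure on G_k(R^m). *)
Definition invariant_on_grassmannian (k : nat) (nu : probability lin_subspace R) :=
  nu (grassmannian k) = 1%E /\
  forall O : 'M[R]_m, O *m O^T = 1%:M ->
  forall A : set lin_subspace, measurable A ->
    nu (subspace_act O @` A) = nu A.

(* A k x m matrix whose rows form an orthonormal basis of xi, for xi in
   G_k(R^m). *)
Definition orthonormal_basis (k : nat) xi : 'M[R]_(k, m) :=
  xget 0 [set B : 'M[R]_(k, m) | B *m B^T = 1%:M /\
                                forall y : 'rV_m, (y \in xi) = (y <= B)%MS].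

(* S^k_xi, the unit sphere of the span of xi and e_n, where n = m + 1. *)
Definition subsphere xi : set ('rV[R]_m * R) :=
  [set theta | enorm theta = 1 /\ theta.1 \in xi].

(* Its surface area measure is carried over from S^k by the linear isometry
   R^k * R -> xi + R e_n given by an orthonormal basis of xi; the choice of the
   basis is immaterial because the measure on S^k is rotation invariant. *)
Definition subsphere_measure (k : nat) xi : set ('rV[R]_m * R) -> \bar R :=
  pushforward (sphere_measure k)
    (fun y : 'rV[R]_k * R => (y.1 *m orthonormal_basis k xi, y.2)).

End subspaces.

Section transform.
Context {R : realType} (m k : nat).

Notation mu1 := (@lebesgue_measure R).

Definition J (f : 'rV[R]_m * R -> R) (x : 'rV[R]_m * R)
    (xi : lin_subspace R m) : \bar R :=
  ((sphere_area k)^-1%:E * \int[subsphere_measure k xi]_(theta in subsphere xi)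
     (f (x.1 + x.2 *: theta.1, x.2 + x.2 * theta.2)%R)%:E)%E.

Definition c_v : R := 2 `^ ((k%:R - 2) / 2) * sphere_area k.-1 / sphere_area k.

Definition v (u : R -> R) (s : R) : \bar R :=
  ((c_v * s `^ ((k%:R - 2) / 2))%:E *
   \int[mu1]_(t in `](s / 2)%R, +oo[)
     (u t * (t - s / 2) `^ ((k%:R - 2) / 2) / t ^+ k.-1)%R%:E)%E.

(* Both sides of the duality for f and u are multiple integrals, over (x, xi, theta) of
   f (x + x_n theta) u (x_n) and over (x, t) of f x u t times a nonnegative
   kernel. For F y t in place of f y * u t these are the following iterated
   integrals; they are used for nonnegative F only, where by Tonelli they agree
   with the multiple ones. *)
Definition lhs_integral (nu : set (lin_subspace R m) -> \bar R)
    (F : 'rV[R]_m * R -> R -> R) : \bar R :=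
  (\int[lebesgue_rVR m \x nu]_(p in half_space m `*` grassmannian k)
     J (F ^~ p.1.2) p.1 p.2)%E.

Definition rhs_integral (F : 'rV[R]_m * R -> R -> R) : \bar R :=
  (\int[lebesgue_rVR m]_(x in half_space m) v (F x) x.2)%E.

(* Finiteness of int |J f| |u| (or of int |f| |v|) would not suffice, because of
   cancellation inside J f (or v); hence the condition is on the multiple
   integral. It exists in the Lebesgue sense when the integral of the positive
   part or that of the negative part of its integrand is finite. *)
Definition exists_lebesgue
    (I : ('rV[R]_m * R -> R -> R) -> \bar R) (F : 'rV[R]_m * R -> R -> R) :=
  (I (fun y t => Num.max (F y t) 0)%R < +oo)%E \/
  (I (fun y t => Num.max (- F y t) 0)%R < +oo)%E.

End transform.

(* Main.v *)
Require Import Defs.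
From HB Require Import structures.
From mathcomp Require Import all_boot all_order all_algebra.
From mathcomp Require Import all_classical all_reals all_analysis measurable_realfun.
From mathcomp Require Import ring lra.

Set Implicit Arguments.
Unset Strict Implicit.
Unset Printing Implicit Defensive.

Import Order.TTheory GRing.Theory Num.Theory.
Import numFieldNormedType.Exports.

Local Open Scope classical_set_scope.
Local Open Scope ring_scope.

(** For nonnegative Borel f and u, Tonelli's theorem and the invariance of dx'
    under translations reduce the left-hand side to integrals over the height
    t = x_n and the sphere S^k_xi of a function of the heights t and
    t + t theta_n only. The image of the measure of S^k_xi under theta_n has
    density sigma_(k-1) (1 - r^2)^((k-2)/2), whatever xi is, so that xi can be
    integrated out. The substitution s = t + t r turns the right-hand side into
    the same integral over (t, r).

    The density is found by integrating over the cone 0 < |y| <= 1 of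
    R^k * R, first along the directions of R^k by means of the radial form of
    Lebesgue measure, whose constant comes from a Gaussian integral. Rotation
    invariance of Lebesgue measure is obtained from its translation invariance
    by integrating f x * F (x + y O) over (x, y), for a Gaussian f. It allows
    the arbitrary orthonormal bases in the measures of S^k_xi to be replaced
    with bases that depend measurably on xi.

    A signed product f * u is split into its positive and negative parts, one
    of which has a finite integral. Versions of f and u that differ on null
    sets are exchanged by means of the nonnegative case for the indicator of a
    Borel null set. *)

(** Two obstacles shape the proof. The measure on S^k_xi is defined through a basis chosen by
    [xget], of which nothing is known as a function of xi. Tonelli's theorem needs joint
    measurability in (x, xi); it is obtained by running Gram-Schmidt on the rows of the orthogonal
    projection onto xi, the very data that generate the sigma-algebra on subspaces. Moreover f and u
    agree with Borel functions only outside null sets, so that J f need not be measurable; integrals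
    are therefore compared by a lemma that holds for arbitrary functions.

    Spheres are handled through the cones over them: an integral over S^k_xi becomes one over the
    punctured unit ball of the fixed space R^k * R, in which xi occurs only through the matrix of a
    basis. That matrix affects only the horizontal part of the shift x_n theta, which is why a
    translation in x' removes xi.

    The splitting into signs has to take place inside [J] and [v], since the assumption concerns the
    multiple integral. Finiteness of one part makes the corresponding inner integral finite almost
    everywhere, and at such points the two parts recombine into (J f) u and f v. *)

Section measurable_matrix_functions.
Context {R : realType}.

Lemma measurable_mx_entry p q (i : 'I_p) (j : 'I_q) :
  measurable_fun setT (fun M : 'M[R]_(p, q) => M i j).
Proof.
move=> _ B mB; rewrite setTI; apply: sub_sigma_algebra.
by exists (i, j) => //; exists B => //; rewrite setTI.
Qed.

Lemma measurable_fun_mx d (T : measurableType d) p q (D : set T)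
    (f : T -> 'M[R]_(p, q)) :
  (forall i j, measurable_fun D (fun x => f x i j)) -> measurable_fun D f.
Proof.
move=> mf mD; apply: (measurability (@mx_entry_sets R p q)) => //.
move=> _ [_ [[i j] _ [B mB <-]] <-].
rewrite /= setTI.
exact: (mf i j mD B mB).
Qed.

Lemma measurable_fun_mx_entry d (T : measurableType d) p q (D : set T)
    (f : T -> 'M[R]_(p, q)) i j :
  measurable_fun D f -> measurable_fun D (fun x => f x i j).
Proof. by move=> mf; apply: (measurableT_comp (measurable_mx_entry i j)). Qed.

Lemma measurable_fun_mulmx d (T : measurableType d) p q r (D : set T)
    (f : T -> 'M[R]_(p, q)) (g : T -> 'M[R]_(q, r)) :
  measurable_fun D f -> measurable_fun D g ->
  measurable_fun D (fun x => f x *m g x).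
Proof.
move=> mf mg; apply: measurable_fun_mx => i j.
under eq_fun do rewrite mxE.
apply: measurable_sum => l.
by apply: measurable_funM; apply: measurable_fun_mx_entry.
Qed.

Lemma measurable_fun_addmx d (T : measurableType d) p q (D : set T)
    (f g : T -> 'M[R]_(p, q)) :
  measurable_fun D f -> measurable_fun D g ->
  measurable_fun D (fun x => f x + g x).
Proof.
move=> mf mg; apply: measurable_fun_mx => i j.
under eq_fun do rewrite mxE.
by apply: measurable_funD; apply: measurable_fun_mx_entry.
Qed.

Lemma measurable_fun_scalemx d (T : measurableType d) p q (D : set T)
    (a : T -> R) (g : T -> 'M[R]_(p, q)) :
  measurable_fun D a -> measurable_fun D g ->
  measurable_fun D (fun x => a x *: g x).
Proof.
move=> ma mg; apply: measurable_fun_mx => i j.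
under eq_fun do rewrite mxE.
by apply: measurable_funM => //; apply: measurable_fun_mx_entry.
Qed.

Lemma measurable_fun_oppmx d (T : measurableType d) p q (D : set T)
    (g : T -> 'M[R]_(p, q)) :
  measurable_fun D g -> measurable_fun D (fun x => - g x).
Proof.
move=> mg; under eq_fun do rewrite -scaleN1r.
by apply: measurable_fun_scalemx => //; apply: measurable_cst.
Qed.

Lemma measurable_fun_trmx d (T : measurableType d) p q (D : set T)
    (g : T -> 'M[R]_(p, q)) :
  measurable_fun D g -> measurable_fun D (fun x => (g x)^T).
Proof.
move=> mg; apply: measurable_fun_mx => i j.
under eq_fun do rewrite mxE.
exact: measurable_fun_mx_entry.
Qed.

Lemma measurable_fun_row_mx d (T : measurableType d) m (D : set T)
    (a : T -> R) (y : T -> 'rV[R]_m) :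
  measurable_fun D a -> measurable_fun D y ->
  measurable_fun D (fun x => row_mx (a x)%:M (y x) : 'rV[R]_(1 + m)).
Proof.
move=> ma my; apply: measurable_fun_mx => i j.
case: (splitP j) => l jl.
- rewrite (_ : (fun _ => _) = a)//; apply/funext => x.
  rewrite (_ : j = lshift m l); last exact/val_inj.
  by rewrite row_mxEl mxE (ord1 i) (ord1 l).
- rewrite (_ : (fun _ => _) = (fun x => y x i l)); last first.
    apply/funext => x; rewrite (_ : j = rshift 1 l) ?row_mxEr//.
    exact/val_inj.
  exact: measurable_fun_mx_entry.
Qed.

End measurable_matrix_functions.

(** * Images of measures with density *)

Section weighted_pushforward.
Context d1 d2 (X : measurableType d1) (Y : measurableType d2) (R : realType).
Variables (mu : {measure set X -> \bar R}) (w : X -> \bar R) (phi : X -> Y).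
Hypotheses (mw : measurable_fun setT w) (w0 : forall x, (0 <= w x)%E).
Hypothesis mphi : measurable_fun setT phi.

(** The image under [phi] of the measure with density [w]. Most changes of variables below consist
    in identifying such a measure with a known one on a generating family of intervals. *)
Definition weighted_pushforward (A : set Y) : \bar R :=
  (\int[mu]_(x in phi @^-1` A) w x)%E.

Let measurable_preimage A : measurable A -> measurable (phi @^-1` A).
Proof. by move=> mA; rewrite -[X in measurable X]setTI; exact: mphi. Qed.

Let wpush0 : weighted_pushforward set0 = 0%E.
Proof. by rewrite /weighted_pushforward preimage_set0 integral_set0. Qed.

Let wpush_ge0 A : (0 <= weighted_pushforward A)%E.
Proof. exact: integral_ge0. Qed.

Let wpush_sigma_additive : semi_sigma_additive weighted_pushforward.
Proof.
move=> F mF tF mUF; rewrite /weighted_pushforward preimage_bigcup.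
rewrite ge0_integral_bigcup//; last 3 first.
- by move=> n; apply: measurable_preimage.
- exact: measurable_funTS.
- apply/trivIsetP => /= i j _ _ ij; rewrite -preimage_setI.
  by move/trivIsetP : tF => /(_ _ _ _ _ ij) ->//; rewrite preimage_set0.
by apply: is_cvg_nneseries => n _ _; apply: integral_ge0.
Qed.

HB.instance Definition _ := isMeasure.Build _ _ _
  weighted_pushforward wpush0 wpush_ge0 wpush_sigma_additive.

Import HBNNSimple.

Let integral_wpush_nnsfun (f : {nnsfun Y >-> R}) :
  (\int[weighted_pushforward]_y (f y)%:E =
   \int[mu]_x ((f (phi x))%:E * w x))%E.
Proof.
rewrite integralT_nnsfun sintegralE.
transitivity (\int[mu]_x (\sum_(r \in range f)
    (r%:E * ((\1_(f @^-1` [set r]) (phi x))%:E * w x)))%E)%E; last first.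
  apply: eq_integral => x _.
  rewrite fimfunE -fsumEFin// ge0_mule_fsuml; last first.
    by move=> r; rewrite nnfun_muleindic_ge0.
  by apply: eq_fsbigr => r _; rewrite EFinM muleA.
have mg r : measurable_fun setT
    (fun x => (\1_(f @^-1` [set r]) (phi x))%:E * w x)%E.
  apply: emeasurable_funM => //; apply/measurable_EFinP.
  by apply: (measurableT_comp _ mphi); apply: measurable_indic.
rewrite ge0_integral_fsum//; last 2 first.
- by move=> r; apply: emeasurable_funM => //; apply: measurable_cst.
- move=> r x _; rewrite muleA; apply: mule_ge0 => //.
  exact: nnfun_muleindic_ge0.
apply: eq_fsbigr => r /[!inE] -[y _ fyr].
rewrite ge0_integralZl//; last 2 first.
- by move=> x _; apply: mule_ge0 => //; rewrite lee_fin.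
- by rewrite lee_fin -fyr.
congr (_ * _)%E; rewrite /weighted_pushforward [LHS]integral_mkcond.
apply: eq_integral => x _; rewrite patchE indicE.
rewrite (_ : (phi x \in _) = (x \in phi @^-1` (f @^-1` [set r]))).
  by case: ifPn => _; rewrite ?mul1e ?mul0e.
by apply/idP/idP; rewrite !inE.
Qed.

Lemma ge0_integral_weighted_pushforward (F : Y -> \bar R) :
  measurable_fun setT F -> (forall y, (0 <= F y)%E) ->
  (\int[weighted_pushforward]_y F y = \int[mu]_x (F (phi x) * w x))%E.
Proof.
move=> mF F0; pose f_ := nnsfun_approx measurableT mF.
have Fcvg y : (EFin \o f_ ^~ y) @ \oo --> F y.
  by apply: cvg_nnsfun_approx.
have f_nd y : {homo (f_ ^~ y) : m n / (m <= n)%N >-> m <= n}.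
  by move=> m n mn; exact/lefP/nd_nnsfun_approx.
transitivity (limn (fun n => \int[weighted_pushforward]_y (f_ n y)%:E)%E).
  rewrite -monotone_convergence//.
  - by apply: eq_integral => y _; apply/esym/cvg_lim => //; apply: Fcvg.
  - by move=> n; exact/measurable_EFinP/measurable_funP.
  - by move=> n y _; rewrite lee_fin.
  - by move=> y _ m n mn; rewrite lee_fin f_nd.
under eq_fun do rewrite integral_wpush_nnsfun.
rewrite -monotone_convergence//.
- apply: eq_integral => x _; apply/cvg_lim => //.
  have [wx|] := boolP (w x \is a fin_num).
    by apply: cvgeZr => //; apply: Fcvg.
  rewrite fin_numE negb_and !negbK => /orP[/eqP wx|/eqP wx].
    by have := w0 x; rewrite wx.
  rewrite wx.
  (* Multiplication by +oo is not continuous at 0, so the limit is found by hand: the approximants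
     all vanish where [F] does, and are eventually positive elsewhere. *)
  have [Fx0|Fx0] := eqVneq (F (phi x)) 0%E.
    rewrite Fx0 mul0e; apply: cvg_near_cst; apply: nearW => n.
    suff -> : f_ n (phi x) = 0 by rewrite mul0e.
    apply/eqP; rewrite eq_le fun_ge0 andbT.
    have : ((f_ n (phi x))%:E <= F (phi x))%E .
      have nd : nondecreasing_seq (fun i => (f_ i (phi x))%:E).
        by move=> i j ij; rewrite lee_fin f_nd.
      rewrite -(cvg_lim _ (Fcvg (phi x)))// (cvg_lim _ (ereal_nondecreasing_cvgn nd))//.
      by apply: ereal_sup_ubound; exists n.
    by rewrite Fx0 lee_fin.
  have Fgt0 : (0 < F (phi x))%E by rewrite lt0e Fx0 F0.
  rewrite gt0_muley//; apply: cvg_near_cst.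
  have Fn : \forall n \near \oo, (0 < (f_ n (phi x))%:E)%E.
    exact: (Fcvg _ _ (open_ereal_gt' Fgt0)).
  by near=> n; rewrite gt0_muley//; near: n.
- move=> n; apply: emeasurable_funM => //; apply/measurable_EFinP.
  exact: measurableT_comp.
- by move=> n x _; apply: mule_ge0 => //; rewrite lee_fin.
- by move=> x _ m n mn; apply: lee_wpmul2r => //; rewrite lee_fin f_nd.
Unshelve. all: by end_near.
Qed.

End weighted_pushforward.

(** * Lebesgue measure on the line and affine substitutions *)

Section lebesgue_real.
Context {R : realType}.

(* Lebesgue measure for the canonical measurable structure of R, whose display
   differs from that of measurableTypeR R. *)
Definition leb : set R -> \bar R := @lebesgue_measure R.

Let leb0 : leb set0 = 0%E. Proof. exact: measure0. Qed.
Let leb_ge0 A : (0 <= leb A)%E. Proof. exact: measure_ge0. Qed.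
Let leb_sigma_additive : semi_sigma_additive leb.
Proof. exact: (@measure_semi_sigma_additive _ _ _ (@lebesgue_measure R)). Qed.

HB.instance Definition _ := isMeasure.Build _ R R leb leb0 leb_ge0
  leb_sigma_additive.

Let leb_sigma_finite : sigma_finite setT leb.
Proof. exact: (@sigma_finiteT _ _ _ (@lebesgue_measure R)). Qed.

HB.instance Definition _ := @Measure_isSigmaFinite.Build _ R R leb
  leb_sigma_finite.

(** Half-open intervals determine Lebesgue measure; [mu] is repackaged over [measurableTypeR R], the
    structure for which the uniqueness theorem is stated. *)
Lemma leb_unique (mu : {measure set R -> \bar R}) :
  (forall a b : R, a <= b -> mu `]a, b]%classic = (b - a)%:E) ->
  forall A, measurable A -> leb A = mu A.
Proof.
move=> muE A mA.
pose mu' : set (measurableTypeR R) -> \bar R := mu.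
have mu'0 : mu' set0 = 0%E by exact: measure0.
have mu'ge0 B : (0 <= mu' B)%E by exact: measure_ge0.
have mu's : semi_sigma_additive mu'.
  exact: (@measure_semi_sigma_additive _ _ _ mu).
pose mu'' := HB.pack_for (measure (measurableTypeR R) R) mu'
  (isMeasure.Build _ (measurableTypeR R) R mu' mu'0 mu'ge0 mu's).
apply: (@lebesgue_measure_unique R mu'') => // _ [[a b] _ <-].
have [ab|ba] := leP a b.
  rewrite [RHS](muE _ _ ab) lebesgue_measure_itv/= lte_fin.
  by case: ltgtP ab => // -> _; rewrite subrr.
rewrite set_itv_ge ?measure0 //.
by rewrite -leNgt bnd_simp ltW.
Qed.

Import HBNNSimple.

(** An integral is a difference of suprema over simple functions, and the simple functions for the
    two measurable structures have the same underlying functions. *)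
Lemma integral_leb (D : set R) (f : R -> \bar R) :
  (\int[lebesgue_measure]_(x in D) f x = \int[leb]_(x in D) f x)%E.
Proof.
have toR (h : {nnsfun (measurableTypeR R) >-> R}) :
    exists h' : {nnsfun R >-> R}, h' = h :> (R -> R).
  have mh : @measurable_fun _ _ R R setT h := @measurable_funPT _ _ _ _ h.
  pose h' : {nnsfun R >-> R} := HB.pack (h : R -> R)
    (isMeasurableFun.Build _ _ R R h mh)
    (FiniteImage.Build _ _ h (@fimfunP _ _ h))
    (isNonNegFun.Build _ _ h (@fun_ge0 _ _ h)).
  by exists h'.
have ofR (h : {nnsfun R >-> R}) :
    exists h' : {nnsfun (measurableTypeR R) >-> R}, h' = h :> (R -> R).
  have mh : @measurable_fun _ _ (measurableTypeR R) R setT h :=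
    @measurable_funPT _ _ _ _ h.
  pose h' : {nnsfun (measurableTypeR R) >-> R} := HB.pack (h : R -> R)
    (isMeasurableFun.Build _ _ (measurableTypeR R) R h mh)
    (FiniteImage.Build _ _ h (@fimfunP _ _ h))
    (isNonNegFun.Build _ _ h (@fun_ge0 _ _ h)).
  by exists h'.
rewrite /integral; congr (_ - _)%E; congr ereal_sup; apply/seteqP;
  split => _ [h hf <-].
- by have [h' h'E] := toR h; exists h'; rewrite /= h'E.
- by have [h' h'E] := ofR h; exists h'; rewrite /= h'E.
- by have [h' h'E] := toR h; exists h'; rewrite /= h'E.
- by have [h' h'E] := ofR h; exists h'; rewrite /= h'E.
Qed.

Lemma integral_eq_measure d (T : measurableType d)
    (mu nu : {measure set T -> \bar R}) (F : T -> \bar R) :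
  (forall A, measurable A -> mu A = nu A) ->
  (\int[mu]_x F x = \int[nu]_x F x)%E.
Proof. by move=> muE; apply: eq_measure_integral => A mA _; apply: muE. Qed.

(** The preimage of []x, y]] is an interval of length (y - x) / c, and the constant density c
    restores y - x. *)
Lemma ge0_integral_leb_affine (c a : R) (F : R -> \bar R) : 0 < c ->
  measurable_fun setT F -> (forall x, (0 <= F x)%E) ->
  (\int[leb]_x F x = c%:E * \int[leb]_x F (c * x + a)%R)%E.
Proof.
move=> c0 mF F0.
have mphi : measurable_fun setT (fun x : R => c * x + a).
  by apply: measurable_funD => //; apply: measurable_funM.
have mc : measurable_fun [set: R] (cst c%:E) by apply: measurable_cst.
have c0' (x : R) : (0 <= cst c%:E x)%E by rewrite lee_fin ltW.
rewrite (@integral_eq_measure _ _ leb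
  (weighted_pushforward leb (cst c%:E) (fun x : R => c * x + a))); last first.
  apply: leb_unique => x y xy.
  rewrite [LHS](_ : _ =
    c%:E * leb ((fun z : R => c * z + a)%R @^-1` `]x, y]))%E; last first.
    apply: integral_cst.
    by rewrite -[X in measurable X]setTI; exact: mphi.
  rewrite (_ : _ @^-1` _ = `](x - a) / c, (y - a) / c]%classic); last first.
    apply/seteqP; split => z /=; rewrite !in_itv/= ltr_pdivrMr// ler_pdivlMr//;
      by rewrite ltrBlDr lerBrDr (mulrC z).
  rewrite /leb lebesgue_measure_itv/= lte_fin ltr_pM2r ?invr_gt0// ltrD2r.
  case: ltgtP xy => // [xy _|-> _].
    by rewrite -EFinM; congr (_%:E); field; rewrite gt_eqF.
  by rewrite mule0 subrr.
rewrite ge0_integral_weighted_pushforward//.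
under eq_integral do rewrite muleC.
rewrite ge0_integralZl//; first exact: measurableT_comp.
by rewrite lee_fin ltW.
Qed.

Lemma ge0_integral_leb_translation (a : R) (F : R -> \bar R) :
  measurable_fun setT F -> (forall x, (0 <= F x)%E) ->
  (\int[leb]_x F x = \int[leb]_x F (x + a)%R)%E.
Proof.
move=> mF F0; rewrite (@ge0_integral_leb_affine 1 a)// mul1e.
by apply: eq_integral => x _; rewrite mul1r.
Qed.

End lebesgue_real.

Section pushforward_sigma_finite.
Context d1 d2 (X : measurableType d1) (Y : measurableType d2) (R : realType).

Lemma sigma_finite_pushforward (mu : {measure set X -> \bar R})
    (phi : X -> Y) (psi : Y -> X) :
  sigma_finite setT mu -> measurable_fun setT psi -> cancel phi psi ->
  sigma_finite setT (pushforward mu phi).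
Proof.
move=> [F FT Foo] mpsi phiK.
exists (fun i => psi @^-1` F i).
  by rewrite -preimage_bigcup -FT preimage_setT.
move=> i; have [mFi Fioo] := Foo i; split.
  by rewrite -[X in measurable X]setTI; exact: mpsi.
rewrite /pushforward (_ : _ @^-1` _ = F i)//.
by apply/seteqP; split => x /=; rewrite phiK.
Qed.

Lemma sigma_finite_product (mu : {sigma_finite_measure set X -> \bar R})
    (nu : {sigma_finite_measure set Y -> \bar R}) :
  sigma_finite setT (mu \x nu)%E.
Proof.
have /sigma_finiteP[F [TF ndF Foo]] := sigma_finiteT mu.
have /sigma_finiteP[G [TG ndG Goo]] := sigma_finiteT nu.
(* The covers were chosen nondecreasing so that the diagonal products already cover the product
   space. *)
exists (fun n => F n `*` G n).
  apply/seteqP; split => // -[x y] _.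
  have [i _ Fx] : (\bigcup_i F i) x by rewrite -TF.
  have [j _ Gy] : (\bigcup_i G i) y by rewrite -TG.
  exists (maxn i j) => //; split.
    by apply: (subsetPset _ _ (ndF _ _ (leq_maxl i j))).
  by apply: (subsetPset _ _ (ndG _ _ (leq_maxr i j))).
move=> i; have [mF Fi] := Foo i; have [mG Gi] := Goo i.
split; first exact: measurableX.
by rewrite product_measure1E// lte_mul_pinfty// ge0_fin_numE.
Qed.

End pushforward_sigma_finite.

(** * Lebesgue measure on row vectors as a sigma-finite measure *)

Section lebesgue_rV_measure.
Context {R : realType}.

Let cons_rV m (p : R * 'rV[R]_m) : 'rV[R]_m.+1 := row_mx p.1%:M p.2.
Let uncons_rV m (y : 'rV[R]_m.+1) : R * 'rV[R]_m :=
  (y 0 0, rsubmx (y : 'rV[R]_(1 + m))).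

Let measurable_cons_rV m : measurable_fun setT (@cons_rV m).
Proof.
by apply: (@measurable_fun_row_mx R _ (R * 'rV[R]_m)%type m setT fst snd).
Qed.

Let measurable_uncons_rV m : measurable_fun setT (@uncons_rV m).
Proof.
apply: measurable_fun_pair; first exact: measurable_mx_entry.
apply: measurable_fun_mx => i j; rewrite [X in measurable_fun _ X](_ : _ =
  (fun x : 'rV[R]_m.+1 => x i (rshift 1 j))).
  exact: measurable_mx_entry.
by apply/funext => x; rewrite mxE.
Qed.

Let cons_rVK m : cancel (@cons_rV m) (@uncons_rV m).
Proof.
move=> [a y]; rewrite /uncons_rV /cons_rV/= row_mxKr; congr pair.
by rewrite mxE; case: splitP => // j _; rewrite mxE (ord1 j).
Qed.

Let lebesgue_rVSE m : @lebesgue_rV R m.+1 =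
  pushforward (leb \x lebesgue_rV m)%E (@cons_rV m).
Proof.
by apply/funext => A; rewrite /pushforward /product_measure1 -integral_leb.
Qed.

(** The product in dimension m + 1 is a measure only once the factor of dimension m is known to be a
    sigma-finite one. Both properties are thus carried through the induction by a packaged measure
    with the right underlying function. *)
Let lebesgue_rV_spec m : {mu : {sigma_finite_measure set 'rV[R]_m -> \bar R} |
  (mu : set 'rV[R]_m -> \bar R) = lebesgue_rV m}.
Proof.
elim: m => [|m [mu muE]].
  by exists (\d_(0 : 'rV[R]_0) : {sigma_finite_measure set 'rV[R]_0 -> \bar R}).
pose nu : set 'rV[R]_m.+1 -> \bar R := pushforward (leb \x mu)%E (@cons_rV m).
have nu0 : nu set0 = 0%E by exact: measure0.
have nu_ge0 A : (0 <= nu A)%E by exact: measure_ge0.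
have mcons := @measurable_cons_rV m.
have nu_sigma : semi_sigma_additive nu.
  exact: (@measure_semi_sigma_additive _ _ _
    (measure_function_pushforward__canonical__measure_function_Measure
       (leb \x mu)%E mcons)).
have nu_fin : sigma_finite setT nu.
  have := @sigma_finite_pushforward _ _ (R * 'rV[R]_m)%type
    'rV[R]_m.+1 R (leb \x mu)%E (@cons_rV m)
    (@uncons_rV m) (sigma_finite_product leb mu) (@measurable_uncons_rV m) (@cons_rVK m).
  exact.
pose M0 := isMeasure.Build _ _ _ nu nu0 nu_ge0 nu_sigma.
pose nuM : {measure set 'rV[R]_m.+1 -> \bar R} := HB.pack nu M0.
pose M1 := @Measure_isSigmaFinite.Build _ _ _ nuM nu_fin.
pose nuS : {sigma_finite_measure set 'rV[R]_m.+1 -> \bar R} := HB.pack nu nuM M1.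
exists nuS.
by rewrite lebesgue_rVSE -muE.
Qed.

Let lebesgue_rV0 m : @lebesgue_rV R m set0 = 0%E.
Proof. by have [mu <-] := lebesgue_rV_spec m; exact: measure0. Qed.
Let lebesgue_rV_ge0 m A : (0 <= @lebesgue_rV R m A)%E.
Proof. by have [mu <-] := lebesgue_rV_spec m; exact: measure_ge0. Qed.
Let lebesgue_rV_sigma_additive m : semi_sigma_additive (@lebesgue_rV R m).
Proof.
have [mu <-] := lebesgue_rV_spec m.
exact: (@measure_semi_sigma_additive _ _ _ mu).
Qed.

HB.instance Definition _ m := isMeasure.Build _ _ _ (@lebesgue_rV R m)
  (@lebesgue_rV0 m) (@lebesgue_rV_ge0 m) (@lebesgue_rV_sigma_additive m).

Let lebesgue_rV_sigma_finite m : sigma_finite setT (@lebesgue_rV R m).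
Proof.
have [mu <-] := lebesgue_rV_spec m.
exact: (@sigma_finiteT _ _ _ mu).
Qed.

HB.instance Definition _ m := @Measure_isSigmaFinite.Build _ _ _
  (@lebesgue_rV R m) (@lebesgue_rV_sigma_finite m).

HB.instance Definition _ m := isMeasure.Build _ _ _ (@lebesgue_rVR R m)
  (measure0 (@lebesgue_rV R m \x leb)%E)
  (measure_ge0 (@lebesgue_rV R m \x leb)%E)
  (@measure_semi_sigma_additive _ _ _ (@lebesgue_rV R m \x leb)%E).

HB.instance Definition _ m := @Measure_isSigmaFinite.Build _ _ _
  (@lebesgue_rVR R m) (sigma_finite_product (@lebesgue_rV R m) leb).

Lemma ge0_integral_rV0 (F : 'rV[R]_0 -> \bar R) :
  measurable_fun setT F -> (\int[lebesgue_rV 0]_y F y = F 0%R)%E.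
Proof. by move=> mF; rewrite integral_dirac// diracE mem_set// mul1e. Qed.

Lemma ge0_integral_rVS m (F : 'rV[R]_m.+1 -> \bar R) :
  measurable_fun setT F -> (forall y, 0 <= F y)%E ->
  (\int[lebesgue_rV m.+1]_y F y =
   \int[leb]_a \int[lebesgue_rV m]_y F (row_mx a%:M y : 'rV[R]_(1 + m)))%E.
Proof.
move=> mF F0.
transitivity (\int[(leb \x lebesgue_rV m)%E]_p F (@cons_rV m p))%E.
  have mcons := @measurable_cons_rV m.
  rewrite -[RHS](@ge0_integral_pushforward _ _ _ _ _ _ mcons _ setT F)//.
  apply: integral_eq_measure => A _.
  exact: (congr1 (fun mu => mu A) (lebesgue_rVSE m)).
have mFc : measurable_fun setT (F \o @cons_rV m).
  exact: (measurableT_comp mF (@measurable_cons_rV m)).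
exact: (@fubini_tonelli1 _ _ _ _ _ leb (lebesgue_rV m) _ mFc (fun p => F0 _)).
Qed.

Lemma ge0_integral_rVR_swap m (F : 'rV[R]_m * R -> \bar R) :
  measurable_fun setT F -> (forall y, 0 <= F y)%E ->
  (\int[lebesgue_rVR m]_y F y =
   \int[leb]_s \int[lebesgue_rV m]_y F (y, s))%E.
Proof. exact: (@fubini_tonelli2 _ _ _ _ _ (lebesgue_rV m) leb). Qed.

End lebesgue_rV_measure.

(** * Tonelli's theorem for parametrized integrals, and routine measurability *)

Section parametrized_integral.
Context d1 d2 (X : measurableType d1) (Y : measurableType d2) (R : realType).
Variable nu : {sigma_finite_measure set Y -> \bar R}.

Lemma measurable_fun_integral (F : X -> Y -> \bar R) :
  measurable_fun setT (fun p : X * Y => F p.1 p.2) ->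
  (forall x y, (0 <= F x y)%E) ->
  measurable_fun setT (fun x => \int[nu]_y F x y)%E.
Proof.
move=> mF F0.
exact: (@measurable_fun_fubini_tonelli_F _ _ _ _ _ nu _ mF (fun p => F0 _ _)).
Qed.

Lemma ge0_integral_exchange (mu : {sigma_finite_measure set X -> \bar R})
    (F : X -> Y -> \bar R) :
  measurable_fun setT (fun p : X * Y => F p.1 p.2) ->
  (forall x y, (0 <= F x y)%E) ->
  (\int[mu]_x \int[nu]_y F x y = \int[nu]_y \int[mu]_x F x y)%E.
Proof.
move=> mF F0.
exact: (@fubini_tonelli _ _ _ _ _ mu nu _ mF (fun p => F0 _ _)).
Qed.

End parametrized_integral.

Lemma measurable_sqrt (R : realType) : measurable_fun setT (@Num.sqrt R).
Proof. exact: continuous_measurable_fun (@sqrt_continuous R). Qed.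

(** Powers with a real exponent are measurable on the whole line, and x^-1 is x times the power -1
    of x^2; at 0 both are 0 because of the convention 0^-1 = 0. *)
Lemma measurable_invr (R : realType) : measurable_fun [set: R] (@GRing.inv R).
Proof.
rewrite (_ : GRing.inv = (fun x => x * (x ^+ 2) `^ (-1))).
  apply: measurable_funM => //.
  exact: (measurableT_comp (@measurable_powR R _)).
apply/funext => x; rewrite powR_inv1 ?sqr_ge0// expr2 invfM mulrA.
by have [->|x0] := eqVneq x 0; rewrite ?invr0 ?mul0r ?mulr0// divff ?mul1r.
Qed.

Ltac measurability_step := first
  [ assumption
  | match goal with
    | |- measurable_fun _ (fun=> ?c) => exact: measurable_cst
    | |- measurable_fun _ (fun x => x) => exact: measurable_id
    | |- measurable_fun _ expR => exact: measurable_expR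
    | |- measurable_fun _ fst => exact: measurable_fst
    | |- measurable_fun _ snd => exact: measurable_snd
    | |- measurable_fun _ (fun x => (@?f x, @?g x)) =>
        apply: (@measurable_fun_pair _ _ _ _ _ _ f g)
    | |- measurable_fun _ (fun x => (@?f x).1) =>
        apply: (@measurableT_comp _ _ _ _ _ _ fst _ f); [exact: measurable_fst|]
    | |- measurable_fun _ (fun x => (@?f x).2) =>
        apply: (@measurableT_comp _ _ _ _ _ _ snd _ f); [exact: measurable_snd|]
    | |- measurable_fun _ (fun x => (@?f x)%:E) => apply/measurable_EFinP
    | |- measurable_fun _ (EFin \o _) => apply/measurable_EFinP
    | |- measurable_fun _ (fun x => (@?f x * @?g x)%E) =>
        apply: (@emeasurable_funM _ _ _ _ f g)
    | |- measurable_fun _ (fun x => row_mx (@?f x)%:M (@?g x)) =>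
        apply: (@measurable_fun_row_mx _ _ _ _ _ f g)
    | |- measurable_fun _ (fun x => fun_of_matrix (@?f x) _ _) =>
        apply: (@measurable_fun_mx_entry _ _ _ _ _ _ f)
    | |- measurable_fun _ (fun x => (@?f x *m @?g x)) =>
        apply: (@measurable_fun_mulmx _ _ _ _ _ _ _ f g)
    | |- measurable_fun _ (fun x => (@?f x *: @?g x)%R) =>
        apply: (@measurable_fun_scalemx _ _ _ _ _ _ f g)
    | |- measurable_fun _ (fun x => (@?f x * @?g x)%R) =>
        apply: (@measurable_funM _ _ _ _ f g)
    | |- measurable_fun _ (fun x => (@?f x + @?g x)%R) =>
        first [ apply: (@measurable_funD _ _ _ _ f g)
              | apply: (@measurable_fun_addmx _ _ _ _ _ _ f g) ]
    | |- measurable_fun _ (fun x => (- @?f x)%R) =>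
        first [ apply: (@measurable_funN _ _ _ _ f)
              | apply: (@measurable_fun_oppmx _ _ _ _ _ _ f) ]
    | |- measurable_fun _ (fun x => (@?f x ^+ _)%R) =>
        apply: (@measurable_funX _ _ _ _ f)
    | |- measurable_fun _ (fun x => expR (@?f x)) =>
        apply: (measurableT_comp (@measurable_expR _) (g := f))
    | |- measurable_fun _ (fun x => (@?f x)^-1) =>
        apply: (measurableT_comp (@measurable_invr _) (g := f))
    | |- measurable_fun _ (fun x => `|@?f x|) =>
        apply: (measurableT_comp (@normr_measurable _ setT) (g := f))
    | |- measurable_fun _ (fun x => Num.sqrt (@?f x)) =>
        apply: (measurableT_comp (@measurable_sqrt _) (g := f))
    | |- measurable_fun _ (fun x => ((@?f x) `^ _)%R) =>
        apply: (measurableT_comp (@measurable_powR _ _) (g := f))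
    | |- measurable_fun _ (fun x => bigop.body _ _ _) =>
        apply: measurable_sum => ?
    | H : measurable_fun setT ?F |- measurable_fun _ (fun x => ?F (@?f x)) =>
        apply: (@measurableT_comp _ _ _ _ _ _ F _ f); [exact: H|]
    end ].

Ltac measurability := repeat measurability_step.

(** * Translations and dilations of Lebesgue measure *)

Section lebesgue_rV_invariance.
Context {R : realType}.

Lemma ge0_integral_rV_translation m (a : 'rV[R]_m) (F : 'rV[R]_m -> \bar R) :
  measurable_fun setT F -> (forall y, 0 <= F y)%E ->
  (\int[lebesgue_rV m]_y F (y + a)%R = \int[lebesgue_rV m]_y F y)%E.
Proof.
elim: m a F => [|m IHm] a F mF F0.
  by apply: eq_integral => y _; congr F; apply/rowP => -[].
rewrite ge0_integral_rVS//; last by measurability.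
rewrite (ge0_integral_rVS mF F0).
pose a0 := a 0 0; pose a' := rsubmx (a : 'rV[R]_(1 + m)).
have aE : a = row_mx a0%:M a'.
  apply/rowP => j; rewrite mxE; case: splitP => i ij.
    by rewrite mxE (ord1 i); congr (a _ _); apply/val_inj; rewrite /= ij (ord1 i).
  by rewrite mxE; congr (a _ _); apply/val_inj.
have -> : (\int[leb]_s \int[lebesgue_rV m]_y
      F ((row_mx s%:M y : 'rV[R]_(1 + m)) + a)%R =
    \int[leb]_s \int[lebesgue_rV m]_y
      F (row_mx (s + a0)%:M (y + a') : 'rV[R]_(1 + m)))%E.
  apply: eq_integral => s _; apply: eq_integral => y _; congr F.
  by rewrite [in LHS]aE add_row_mx -raddfD.
have mG : measurable_fun setT (fun p : R * 'rV[R]_m =>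
    F (row_mx p.1%:M p.2 : 'rV[R]_(1 + m))) by measurability.
rewrite -(ge0_integral_leb_translation a0 (F := fun s =>
  (\int[lebesgue_rV m]_y F (row_mx s%:M (y + a') : 'rV[R]_(1 + m)))%E)).
- apply: eq_integral => s _.
  rewrite (IHm a' (fun y => F (row_mx s%:M y : 'rV[R]_(1 + m))))//.
  by measurability.
- apply: measurable_fun_integral => //.
  apply: (measurableT_comp mF); measurability.
- by move=> s; apply: integral_ge0.
Qed.

Lemma ge0_integral_rV_scale m (c : R) (F : 'rV[R]_m -> \bar R) : 0 < c ->
  measurable_fun setT F -> (forall y, 0 <= F y)%E ->
  (\int[lebesgue_rV m]_y F y =
   (c ^+ m)%:E * \int[lebesgue_rV m]_y F (c *: y)%R)%E.
Proof.
move=> c0; elim: m F => [|m IHm] F mF F0.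
  rewrite expr0 mul1e.
  by apply: eq_integral => y _; congr F; apply/rowP => -[].
rewrite ge0_integral_rVS// ge0_integral_rVS//; last by measurability.
have mG : measurable_fun setT (fun p : R * 'rV[R]_m =>
    F (row_mx p.1%:M p.2 : 'rV[R]_(1 + m))) by measurability.
rewrite (ge0_integral_leb_affine 0 c0); last 2 first.
- exact: measurable_fun_integral.
- by move=> s; apply: integral_ge0.
have -> : (\int[leb]_s \int[lebesgue_rV m]_y
      F (c *: (row_mx s%:M y : 'rV[R]_(1 + m)))%R =
    \int[leb]_s \int[lebesgue_rV m]_y
      F (row_mx (c * s + 0)%:M (c *: y) : 'rV[R]_(1 + m)))%E.
  apply: eq_integral => s _; apply: eq_integral => y _; congr F.
  by rewrite scale_row_mx scale_scalar_mx addr0.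
under eq_integral => s _.
  rewrite (IHm (fun y => F (row_mx (c * s + 0)%:M y : 'rV[R]_(1 + m))))//; last first.
    by measurability.
  over.
rewrite ge0_integralZl//.
- by rewrite exprS EFinM muleA.
- apply: (@measurable_fun_integral _ _ _ _ _ (lebesgue_rV m)
    (fun s y => F (row_mx (c * s + 0)%:M (c *: y) : 'rV[R]_(1 + m)))) => //.
  by measurability.
- by move=> s _; apply: integral_ge0.
- by rewrite lee_fin exprn_ge0// ltW.
Qed.

End lebesgue_rV_invariance.

(** * Gaussian integrals and rotation invariance *)

Section sqnorm.
Context {R : realType}.

Definition sqnorm m (y : 'rV[R]_m) : R := \sum_i y 0 i ^+ 2.

Lemma sqnormE m (y : 'rV[R]_m) : sqnorm y = (y *m y^T) 0 0.
Proof. by rewrite mxE; apply: eq_bigr => i _; rewrite mxE. Qed.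

Lemma sqnorm_ge0 m (y : 'rV[R]_m) : 0 <= sqnorm y.
Proof. by apply: sumr_ge0 => i _; exact: sqr_ge0. Qed.

Lemma sqnormZ m (c : R) (y : 'rV[R]_m) : sqnorm (c *: y) = c ^+ 2 * sqnorm y.
Proof.
by rewrite /sqnorm mulr_sumr; apply: eq_bigr => i _; rewrite mxE exprMn.
Qed.

Lemma sqnormN m (y : 'rV[R]_m) : sqnorm (- y) = sqnorm y.
Proof. by rewrite -scaleN1r sqnormZ sqrrN expr1n mul1r. Qed.

Lemma sqnorm_row_mx m (a : R) (y : 'rV[R]_m) :
  sqnorm (row_mx a%:M y : 'rV[R]_(1 + m)) = a ^+ 2 + sqnorm y.
Proof.
rewrite /sqnorm big_split_ord big_ord1; congr (_ + _).
  by rewrite row_mxEl mxE.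
by apply: eq_bigr => i _; rewrite row_mxEr.
Qed.

Lemma sqnorm_mulmx p m (y : 'rV[R]_p) (B : 'M[R]_(p, m)) :
  B *m B^T = 1%:M -> sqnorm (y *m B) = sqnorm y.
Proof.
move=> BB; rewrite !sqnormE trmx_mul mulmxA -(mulmxA y) BB.
by rewrite mulmx1.
Qed.

Lemma measurable_sqnorm m : measurable_fun setT (@sqnorm m).
Proof. by rewrite /sqnorm; measurability. Qed.

(** The Gaussian factors over the coordinates. It serves as the rotation invariant weight in the
    next lemma, as a majorant for the volume of balls, and to evaluate the constant of polar
    coordinates. *)
Lemma integral_rV_gauss m :
  (\int[lebesgue_rV m]_y (expR (- sqnorm y))%:E = (Num.sqrt pi ^+ m)%:E)%E.
Proof.
have mg p : measurable_fun setT (fun y : 'rV[R]_p => (expR (- sqnorm y))%:E).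
  by have := measurable_sqnorm (m := p) => ?; measurability.
have g0 p (y : 'rV[R]_p) : (0 <= (expR (- sqnorm y))%:E)%E.
  by rewrite lee_fin expR_ge0.
elim: m => [|m IHm].
  by rewrite ge0_integral_rV0// /sqnorm big_ord0 oppr0 expR0.
rewrite ge0_integral_rVS//.
transitivity (\int[leb]_a ((expR (- a ^+ 2))%:E *
    (Num.sqrt (pi : R) ^+ m)%:E))%E.
  apply: eq_integral => a _.
  transitivity (\int[lebesgue_rV m]_y
      ((expR (- a ^+ 2))%:E * (expR (- sqnorm y))%:E))%E.
    by apply: eq_integral => y _; rewrite sqnorm_row_mx opprD expRD EFinM.
  by rewrite ge0_integralZl// IHm.
rewrite ge0_integralZr//; last by measurability.
rewrite exprS EFinM; congr (_ * _)%E.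
by rewrite -integral_leb -integralT_gauss.
Qed.

(** For fixed x, the translation of y by x O^T turns F (y O) into F (x + y O), since O^T O = 1. For
    fixed y, the translation of x by y O turns the integrand into f (x - y O) F x. As x - y O and x
    O^T - y have the same norm and f is even, the integral over y then gives the total mass of f,
    whatever x is. *)
Lemma ge0_integral_rV_rotation m (O : 'M[R]_m) (F : 'rV[R]_m -> \bar R) :
  O *m O^T = 1%:M -> measurable_fun setT F -> (forall y, 0 <= F y)%E ->
  (\int[lebesgue_rV m]_y F (y *m O)%R = \int[lebesgue_rV m]_y F y)%E.
Proof.
move=> OO mF F0; have OO' := mulmx1C OO.
pose f (y : 'rV[R]_m) := (expR (- sqnorm y))%:E.
have f0 y : (0 <= f y)%E by rewrite lee_fin expR_ge0.
have mf : measurable_fun setT f.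
  by have := measurable_sqnorm (m := m) => ?; rewrite /f; measurability.
pose c := Num.sqrt (pi : R) ^+ m.
have c0 : 0 < c by rewrite exprn_gt0// sqrtr_gt0 pi_gt0.
have fE : (\int[lebesgue_rV m]_y f y = c%:E)%E by exact: integral_rV_gauss.
(* The mass [c] of the Gaussian is finite and positive, so it can be cancelled even from infinite
   integrals. *)
have cK (x : \bar R) : ((c^-1)%:E * (c%:E * x) = x)%E.
  by rewrite muleA -EFinM mulVf ?mul1e// gt_eqF.
rewrite -[LHS]cK -[RHS]cK; congr (_ * _)%E.
have mFy : measurable_fun setT (fun y => F (y *m O)) by measurability.
have mxy : measurable_fun setT
    (fun p : 'rV[R]_m * 'rV[R]_m => (f p.1 * F (p.1 + p.2 *m O)%R)%E).
  by measurability.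
transitivity (\int[lebesgue_rV m]_x \int[lebesgue_rV m]_y
    (f x * F (x + y *m O)%R))%E.
  transitivity (\int[lebesgue_rV m]_x
      (f x * \int[lebesgue_rV m]_y F (y *m O)%R))%E.
    rewrite ge0_integralZr//; first by rewrite fE.
    exact: integral_ge0.
  apply: eq_integral => x _.
  rewrite -(ge0_integral_rV_translation (x *m O^T) mFy)//.
  have -> : (\int[lebesgue_rV m]_y F ((y + x *m O^T) *m O)%R =
             \int[lebesgue_rV m]_y F (x + y *m O)%R)%E.
    apply: eq_integral => y _.
    by rewrite mulmxDl -mulmxA OO' mulmx1 addrC.
  by rewrite ge0_integralZl//; measurability.
rewrite ge0_integral_exchange//; last by move=> x y; rewrite mule_ge0.
have mxy' : measurable_fun setT
    (fun p : 'rV[R]_m * 'rV[R]_m => (f (p.1 - p.2 *m O)%R * F p.1)%E).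
  by measurability.
transitivity (\int[lebesgue_rV m]_y \int[lebesgue_rV m]_x
    (f (x - y *m O)%R * F x))%E.
  apply: eq_integral => y _.
  have mg : measurable_fun setT (fun x : 'rV[R]_m => (f (x - y *m O)%R * F x)%E).
    by measurability.
  rewrite -(ge0_integral_rV_translation (y *m O) mg); last first.
    by move=> x; rewrite mule_ge0.
  by apply: eq_integral => x _; rewrite addrK.
rewrite -ge0_integral_exchange//; last by move=> x y; rewrite mule_ge0.
rewrite -ge0_integralZl//; last by rewrite lee_fin ltW.
apply: eq_integral => x _.
rewrite ge0_integralZr//; last by measurability.
congr (_ * _)%E; rewrite -fE -[RHS](ge0_integral_rV_translation (- (x *m O^T)) mf f0).
apply: eq_integral => y _; rewrite /f; congr (expR (- _))%:E.
rewrite -(@sqnorm_mulmx _ _ (x - y *m O) O^T) ?trmxK//.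
by rewrite mulmxBl -mulmxA OO mulmx1 -opprB sqnormN.
Qed.

End sqnorm.

(** * Change of variables on the line *)

Section one_dimensional_integrals.
Context {R : realType}.

(** Domains are moved into the integrand so that Tonelli's theorem and the substitutions can be
    stated on whole spaces. *)
Lemma integral_indicl d (T : measurableType d) (mu : {measure set T -> \bar R})
    (D : set T) (f : T -> \bar R) :
  (\int[mu]_(x in D) f x = \int[mu]_x ((\1_D x)%:E * f x))%E.
Proof.
rewrite integral_mkcond; apply: eq_integral => x _.
by rewrite patchE indicE; case: ifPn => _; rewrite ?mul1e ?mul0e.
Qed.

Lemma is_derive_continuous (F : R -> R) (x l : R) :
  is_derive x 1 F l -> {for x, continuous F}.
Proof.
move=> Fl; apply: differentiable_continuous; apply/derivable1_diffP.
exact: ex_derive.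
Qed.

Lemma integral_leb_derive (F f : R -> R) (a b : R) : a <= b ->
  (forall x, a <= x <= b -> is_derive x 1 F (f x)) ->
  (forall x, a <= x <= b -> {for x, continuous f}) ->
  measurable_fun setT f ->
  (\int[leb]_(x in `]a, b]) (f x)%:E = (F b - F a)%:E)%E.
Proof.
move=> ab dF cf mf.
rewrite -integral_leb integral_itv_obnd_cbnd; last first.
  by apply: measurable_funTS; apply/measurable_EFinP.
move: ab; rewrite le_eqVlt => /predU1P[<-|ab].
  by rewrite set_itv1 integral_set1 subrr.
rewrite EFinB; apply: continuous_FTC2 => //.
- apply: continuous_in_subspaceT => x; rewrite inE/= in_itv/= => xab.
  exact: cf.
- split.
  + move=> x; rewrite in_itv/= => /andP[ax xb].
    by have := dF x; rewrite !ltW// => /(_ isT) ?; exact: ex_derive.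
  + apply: cvg_at_right_filter.
    by apply: is_derive_continuous; apply: dF; rewrite lexx ltW.
  + apply: cvg_at_left_filter.
    by apply: is_derive_continuous; apply: dF; rewrite lexx ltW.
- move=> x; rewrite in_itv/= => /andP[ax xb].
  by have := dF x; rewrite !ltW// => /(_ isT) ?; rewrite derive1E derive_val.
Qed.

(** The equivalence between [phi x <= y] and [x <= psi y] makes the preimage of []a, b]] in I equal
    to []psi a, psi b]]. The fundamental theorem of calculus gives it the weight phi (psi b) - phi
    (psi a) = b - a, so the image of the density [dphi] is Lebesgue measure. *)
Lemma ge0_integral_substitution (I : set R) (phi psi dphi : R -> R)
    (F : R -> \bar R) :
  measurable I -> (forall y, I (psi y)) ->
  (forall a b x, I a -> I b -> a <= x <= b -> I x) ->
  (forall x y, I x -> (phi x <= y) = (x <= psi y)) ->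
  cancel psi phi ->
  (forall x, I x -> is_derive x 1 phi (dphi x)) ->
  (forall x, I x -> {for x, continuous dphi}) ->
  (forall x, I x -> 0 <= dphi x) ->
  measurable_fun setT phi -> measurable_fun setT dphi ->
  measurable_fun setT F -> (forall x, (0 <= F x)%E) ->
  (\int[leb]_y F y =
   \int[leb]_x ((\1_I x)%:E * ((dphi x)%:E * F (phi x))))%E.
Proof.
move=> mI Ipsi Iint galois psiK dphiP cdphi dphi0 mphi mdphi mF F0.
pose w x := ((\1_I x)%:E * (dphi x)%:E)%E.
have w0 x : (0 <= w x)%E.
  rewrite /w indicE; case: (boolP (x \in I)) => [|_]; last by rewrite mul0e.
  by rewrite inE => Ix; rewrite mul1e lee_fin dphi0.
have mw : measurable_fun setT w.
  by have := @measurable_indic _ _ R setT _ mI => ?; rewrite /w; measurability.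
rewrite (@integral_eq_measure R _ _ leb (weighted_pushforward leb w phi));
  last first.
  apply: leb_unique => a b ab.
  transitivity (\int[leb]_x ((\1_(phi @^-1` `]a, b]) x)%:E * w x))%E.
    exact: integral_indicl.
  transitivity (\int[leb]_(x in `]psi a, psi b]) (dphi x)%:E)%E; last first.
    have psiab : psi a <= psi b by rewrite -galois// psiK.
    have dphiP' x : psi a <= x <= psi b -> is_derive x 1 phi (dphi x).
      by move=> xab; apply: dphiP; exact: (Iint (psi a) (psi b)).
    rewrite (integral_leb_derive psiab dphiP')// ?psiK// => x xab.
    by apply: cdphi; exact: (Iint (psi a) (psi b)).
  rewrite (integral_indicl leb `]psi a, psi b]%classic); apply: eq_integral => x _.
  rewrite /w !indicE; case: (boolP (x \in I)) => [|xI].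
    rewrite inE => Ix; rewrite mul1e.
    rewrite (_ : (x \in phi @^-1` _) = (x \in `]psi a, psi b]%classic))//.
    apply/idP/idP; rewrite !inE/= !in_itv/= -!galois// => /andP[+ ->].
      by rewrite !ltNge -galois// => ->.
    by rewrite !ltNge -galois// => ->.
  rewrite mul0e mule0; case: (boolP (x \in `]psi a, psi b]%classic)) => [|_].
    rewrite inE/= in_itv/= => /andP[/ltW ax xb]; move: xI; rewrite notin_setE.
    by case; apply: (Iint (psi a) (psi b)) => //; rewrite ax.
  by rewrite mul0e.
rewrite ge0_integral_weighted_pushforward//.
by apply: eq_integral => x _; rewrite /w muleC -muleA.
Qed.

Lemma integral_expn (n : nat) (a : R) : 0 <= a ->
  (\int[leb]_(x in `]0%R, a]) (x ^+ n)%:E = (a ^+ n.+1 / n.+1%:R)%:E)%E.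
Proof.
move=> a0; have dF (x : R) : 0 <= x <= a ->
    is_derive x 1 (fun x => x ^+ n.+1 / n.+1%:R) (x ^+ n).
  move=> _.
  rewrite (_ : (fun _ => _) = n.+1%:R^-1 \*: (id ^+ n.+1)); last first.
    by apply/funext => y; rewrite exprfctE mulrC.
  apply: is_derive_eq (is_deriveZ _ (is_deriveX _ (is_derive_id _ _))) _.
  by rewrite /= [X in _ *: X]mulr1 /GRing.scale/= mulKf// pnatr_eq0.
rewrite (integral_leb_derive a0 dF)//.
  by rewrite expr0n mul0r subr0.
by move=> x _; exact: exprn_continuous.
Qed.

End one_dimensional_integrals.

(** * Polar coordinates for radial functions *)

Section radial.
Context {R : realType}.

Lemma ge0_integral_ln_substitution (F : R -> \bar R) :
  measurable_fun setT F -> (forall x, (0 <= F x)%E) ->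
  (\int[leb]_x ((\1_`]0%R, +oo[ x)%:E * F x) =
   \int[leb]_s (F (expR s) * (expR s)%:E))%E.
Proof.
move=> mF F0.
have mI : measurable (`]0%R, +oo[%classic : set R) by exact: measurable_itv.
have mln := @measurable_ln R.
have mV := measurable_invr.
rewrite [RHS](@ge0_integral_substitution R `]0%R, +oo[%classic (@ln R) expR
  (fun x => x^-1))//.
- apply: eq_integral => x _; rewrite indicE.
  case: (boolP (x \in _)) => [|_]; last by rewrite !mul0e.
  rewrite inE/= in_itv/= andbT => x0; rewrite !mul1e lnK ?posrE//.
  by rewrite muleC -muleA -EFinM divff ?mule1// gt_eqF.
- by move=> y; rewrite /= in_itv/= andbT expR_gt0.
- move=> a b x; rewrite /= !in_itv/= !andbT => a0 _ /andP[ax _].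
  exact: lt_le_trans ax.
- move=> x y; rewrite /= in_itv/= andbT => x0.
  by rewrite -{1}(expRK y) ler_ln ?posrE ?expR_gt0.
- exact: expRK.
- by move=> x; rewrite /= in_itv/= andbT => x0; exact: is_derive1_ln.
- move=> x; rewrite /= in_itv/= andbT => x0.
  by apply: inv_continuous; rewrite gt_eqF.
- by move=> x; rewrite /= in_itv/= andbT => x0; rewrite invr_ge0 ltW.
- by measurability.
- by move=> x; rewrite mule_ge0// lee_fin expR_ge0.
Qed.

(** After x = exp s, squaring x is doubling s, so an affine substitution suffices. *)
Lemma ge0_integral_sqr_substitution (F : R -> \bar R) :
  measurable_fun setT F -> (forall x, (0 <= F x)%E) ->
  (\int[leb]_x ((\1_`]0%R, +oo[ x)%:E * F x) =
   2%:E * \int[leb]_x ((\1_`]0%R, +oo[ x)%:E * (F (x ^+ 2)%R * `|x|%:E)))%E.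
Proof.
move=> mF F0.
rewrite ge0_integral_ln_substitution// ge0_integral_ln_substitution//; last 2 first.
- by measurability.
- by move=> x; rewrite mule_ge0.
rewrite (@ge0_integral_leb_affine _ 2 0)//; last 2 first.
- by measurability.
- by move=> x; rewrite mule_ge0// lee_fin expR_ge0.
congr (_ * _)%E; apply: eq_integral => s _.
rewrite addr0 expRM_natl ger0_norm ?expR_ge0// -muleA -EFinM.
by rewrite -expr2.
Qed.

Let cball m (x : R) := [set y : 'rV[R]_m | Num.sqrt (sqnorm y) < x].

Let measurable_norm m : measurable_fun setT (fun y : 'rV[R]_m => Num.sqrt (sqnorm y)).
Proof. by have := measurable_sqnorm (m := m) (R := R) => ?; measurability. Qed.

Let ballE (m : nat) (x : R) :
  @cball m x = (fun y : 'rV[R]_m => Num.sqrt (sqnorm y)) @^-1` `]-oo, x[%classic.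
Proof. by apply/seteqP; split => y; rewrite /cball/= in_itv. Qed.

Let measurable_ball m x : measurable (@cball m x).
Proof.
rewrite ballE -[X in measurable X]setTI.
by apply: measurable_norm => //; exact: measurable_itv.
Qed.

Let ball_scale m x : 0 < x ->
  lebesgue_rV m (@cball m x) = ((x ^+ m)%:E * lebesgue_rV m (@cball m 1))%E.
Proof.
move=> x0.
have lebE z : lebesgue_rV m (@cball m z) =
    (\int[lebesgue_rV m]_y (\1_(@cball m z) y)%:E)%E.
  by rewrite integral_indic// setIT.
rewrite !lebE (ge0_integral_rV_scale x0)//; last by measurability.
congr (_ * _)%E; apply: eq_integral => y _; rewrite !indicE.
rewrite (_ : (_ \in @cball m x) = (y \in @cball m 1))//.
apply/idP/idP; rewrite !inE /cball/= sqnormZ sqrtrM ?sqr_ge0// sqrtr_sqr;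
  by rewrite gtr0_norm// -ltr_pdivlMl// mulVf// gt_eqF.
Qed.

(** On the unit ball, 1 is at most e times the Gaussian, whose integral is finite. *)
Let ball_fin m : (lebesgue_rV m (@cball m 1) < +oo)%E.
Proof.
have -> : lebesgue_rV m (@cball m 1) =
    (\int[lebesgue_rV m]_y (\1_(@cball m 1) y)%:E)%E.
  by rewrite integral_indic// setIT.
have := measurable_sqnorm (m := m) (R := R) => msq.
apply: (@le_lt_trans _ _
  (\int[lebesgue_rV m]_y ((expR 1)%:E * (expR (- sqnorm y))%:E))%E).
  apply: ge0_le_integral => //; try by measurability.
  move=> y _; rewrite -EFinM lee_fin -expRD indicE.
  case: (boolP (_ \in _)) => [|_]; last by rewrite expR_ge0.
  rewrite inE /cball/= => y1; apply: le_trans (expR_ge1Dx _).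
  rewrite lerDl subr_ge0 -(sqr_sqrtr (sqnorm_ge0 y)) expr_le1 ?sqrtr_ge0//.
  exact: ltW.
rewrite ge0_integralZl//; last by measurability.
by rewrite integral_rV_gauss -EFinM ltry.
Qed.

(** The volume of the ball of radius r in R^(m+1) is r^(m+1) times that of the unit ball; this is
    the coefficient of r^m in its derivative. *)
Let radial_constant m := m.+1%:R * fine (lebesgue_rV m.+1 (@cball m.+1 1)).

Let radial_constant_ge0 m : 0 <= radial_constant m.
Proof. by rewrite mulr_ge0// fine_ge0. Qed.

(** Both sides integrate F against a measure on the line: the image of Lebesgue measure under the
    norm, and a density proportional to r^m. By the scaling of balls these agree on the rays []-oo,
    x[], which form a class stable under intersection. The absolute value keeps the weight
    nonnegative on the whole line. *)
Let ge0_integral_radial_constant m (F : R -> \bar R) :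
  measurable_fun setT F -> (forall x, (0 <= F x)%E) ->
  (\int[lebesgue_rV m.+1]_y F (Num.sqrt (sqnorm y)) =
   (radial_constant m)%:E *
   \int[leb]_r ((\1_`]0%R, +oo[ r)%:E * (F r * (`|r| ^+ m)%:E)))%E.
Proof.
move=> mF F0.
have mI : measurable (`]0%R, +oo[%classic : set R) by exact: measurable_itv.
have mind := @measurable_indic _ _ R setT _ mI.
pose w (r : R) := ((radial_constant m)%:E *
  ((\1_`]0%R, +oo[ r)%:E * (`|r| ^+ m)%:E))%E.
have w0 r : (0 <= w r)%E.
  by rewrite !mule_ge0// lee_fin ?radial_constant_ge0// exprn_ge0.
have mw : measurable_fun setT w by rewrite /w; measurability.
have mn := @measurable_norm m.+1.
have one0 (y : 'rV[R]_m.+1) : (0 <= cst 1%E y :> \bar R)%E by [].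
have mone : measurable_fun [set: 'rV[R]_m.+1] (cst (1%E : \bar R)).
  exact: measurable_cst.
have mid : measurable_fun [set: R] (@idfun R) by exact: measurable_id.
transitivity (\int[weighted_pushforward (lebesgue_rV m.+1) (cst 1%E)
   (fun y => Num.sqrt (sqnorm y))]_r F r)%E.
  rewrite ge0_integral_weighted_pushforward//.
  by apply: eq_integral => y _; rewrite mule1.
transitivity (\int[weighted_pushforward leb w idfun]_r F r)%E; last first.
  rewrite ge0_integral_weighted_pushforward// -ge0_integralZl//.
  - apply: eq_integral => r _; rewrite /w/= [LHS]muleCA; congr (_ * _)%E.
    exact: muleCA.
  - by measurability.
  - by move=> r _; rewrite !mule_ge0// ?lee_fin// exprn_ge0.
  - by rewrite lee_fin radial_constant_ge0.
have E1 x : (weighted_pushforward (lebesgue_rV m.+1) (cst 1%E)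
   (fun y => Num.sqrt (sqnorm y)) `]-oo, x[ = lebesgue_rV m.+1 (@cball m.+1 x))%E.
  rewrite /weighted_pushforward -ballE.
  have := integral_cst (lebesgue_rV m.+1) (@measurable_ball m.+1 x) 1%E.
  by rewrite mul1e.
apply: integral_eq_measure.
apply: (@measure_unique _ R R (@RGenInftyO.G R) (fun n => `]-oo, n%:R[%classic)).
- exact: RGenInftyO.measurableE.
- move=> _ _ [a ->] [b ->]; exists (Num.min a b).
  by apply/seteqP; split => x /=; rewrite !in_itv/= lt_min => /andP.
- by move=> n; exists n%:R.
- apply/seteqP; split => // x _; exists (Num.truncn `|x|).+1 => //=.
  by rewrite in_itv/= (le_lt_trans (ler_norm _))// truncnS_gt.
- move=> _ [x ->]; rewrite [LHS]E1.
  transitivity (\int[leb]_(r in `]-oo, x[) w r)%E => //.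
  have [x0|x0] := leP x 0.
    rewrite integral_indicl (_ : @cball m.+1 x = set0) ?measure0; last first.
      apply/seteqP; split => // y; rewrite /cball/=; apply/negP.
      by rewrite -leNgt (le_trans x0)// sqrtr_ge0.
    apply/esym; apply: integral0_eq => r _; rewrite /w !indicE.
    case: (boolP (r \in `]-oo, x[%classic)) => [|_]; last by rewrite mul0e.
    rewrite inE/= in_itv/= => rx.
    rewrite (_ : (r \in _) = false) ?mul0e ?mule0//.
    apply/negP; rewrite inE/= in_itv/= andbT => r0.
    by have := lt_le_trans rx x0; rewrite ltNge (ltW r0).
  rewrite ball_scale//.
  transitivity ((radial_constant m)%:E * \int[leb]_(r in `]0%R, x]) (r ^+ m)%:E)%E.
    rewrite integral_expn ?ltW// -EFinM /radial_constant.
    rewrite [in LHS](_ : lebesgue_rV m.+1 (@cball m.+1 1) =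
      (fine (lebesgue_rV m.+1 (@cball m.+1 1)))%:E); last first.
      by rewrite fineK// ge0_fin_numE.
    rewrite -EFinM; congr (_%:E).
    have : m.+1%:R != 0 :> R by rewrite pnatr_eq0.
    by move: (fine _) m.+1%:R (x ^+ m.+1) => a b c b0; field.
  have -> : (\int[leb]_(r in `]0%R, x]) (r ^+ m)%:E =
             \int[leb]_(r in `]0%R, x[) (r ^+ m)%:E)%E.
    rewrite -!integral_leb integral_itv_bndo_bndc//.
    by apply: measurable_funTS; measurability.
  have mo : measurable (`]0%R, x[%classic : set R) by exact: measurable_itv.
  have mio := @measurable_indic _ _ R setT _ mo.
  transitivity ((radial_constant m)%:E *
      \int[leb]_r ((\1_`]0%R, x[ r)%:E * (`|r| ^+ m)%:E))%E.
    congr (_ * _)%E; rewrite integral_indicl; apply: eq_integral => r _.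
    rewrite indicE; case: (boolP (r \in _)) => [|_]; last by rewrite !mul0e.
    by rewrite inE/= in_itv/= => /andP[r0 _]; rewrite gtr0_norm.
  have C0 : (0 <= (radial_constant m)%:E)%E by rewrite lee_fin.
  have mg : measurable_fun setT
      (fun r : R => (\1_`]0%R, x[ r)%:E * (`|r| ^+ m)%:E)%E by measurability.
  have g0 r : (0 <= (\1_`]0%R, x[ r)%:E * (`|r| ^+ m)%:E)%E.
    by rewrite mule_ge0// lee_fin exprn_ge0.
  rewrite (integral_indicl leb `]-oo, x[%classic) -ge0_integralZl//.
  apply: eq_integral => r _; rewrite /w [RHS]muleCA; congr (_ * _)%E.
  rewrite [RHS]muleA; congr (_ * _)%E; rewrite -EFinM !indicE -natrM mulnb.
  congr (nat_of_bool _)%:R%:E; apply/idP/andP; rewrite !inE/= !in_itv/= ?andbT.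
    by move=> /andP[].
  by case=> -> ->.
- move=> n; rewrite [X in (X < _)%E]E1.
  have [->|n0] := posnP n.
    rewrite (_ : @cball m.+1 _ = set0) ?measure0//.
    apply/seteqP; split => // y; rewrite /cball/=; apply/negP.
    by rewrite -leNgt sqrtr_ge0.
  by rewrite ball_scale ?ltr0n// lte_mul_pinfty// lee_fin exprn_ge0.
Qed.

(** Let C be the constant and I the integral of exp (- r^2) r^m over r > 0. The Gaussian integral
    over R^(m+1) gives pi^((m+1)/2) = C I, and the substitution t = r^2 gives Gamma ((m+1)/2) = 2
    I. *)
Let radial_constantE m : radial_constant m = sphere_area m.
Proof.
pose I := (\int[@leb R]_r ((\1_`]0%R, +oo[ r)%:E *
  ((expR (- r ^+ 2))%:E * (`|r| ^+ m)%:E)))%E.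
have mI : measurable (`]0%R, +oo[%classic : set R) by exact: measurable_itv.
have gaussE : ((Num.sqrt (pi : R) ^+ m.+1)%:E = (radial_constant m)%:E * I)%E.
  rewrite -integral_rV_gauss.
  rewrite -(ge0_integral_radial_constant m (F := fun r => (expR (- r ^+ 2))%:E)).
  - by apply: eq_integral => y _; rewrite sqr_sqrtr// sqnorm_ge0.
  - by measurability.
  - by move=> x; rewrite lee_fin expR_ge0.
have GammaE : Gamma (m.+1%:R / 2 : R) = fine (2%:E * I)%E.
  rewrite /Gamma /Rintegral; congr fine; rewrite integral_leb integral_indicl.
  rewrite ge0_integral_sqr_substitution; last 2 first.
  - have mp := @measurable_powR R (m.+1%:R / 2 - 1).
    by apply/measurable_EFinP; apply: measurable_funM; measurability.
  - by move=> x; rewrite lee_fin mulr_ge0// ?expR_ge0 ?powR_ge0.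
  congr (_ * _)%E; apply: eq_integral => r _; rewrite indicE.
  case: (boolP (r \in _)) => [|_]; last by rewrite !mul0e.
  rewrite inE/= in_itv/= andbT => r0; rewrite -!EFinM; congr ((_ * _)%:E).
  rewrite mulrC (mulrC (expR _)) mulrA gtr0_norm//; congr (_ * _).
  rewrite -!(powR_mulrn _ (ltW r0)) -powRrM -{1}(powRr1 (ltW r0)) -powRD.
    by congr (_ `^ _); rewrite -natr1; field.
  by rewrite (gt_eqF r0) implybT.
have sp0 : 0 < Num.sqrt (pi : R) ^+ m.+1 by rewrite exprn_gt0// sqrtr_gt0 pi_gt0.
have C0 := radial_constant_ge0 m.
have piE : (pi : R) `^ (m.+1%:R / 2) = Num.sqrt pi ^+ m.+1.
  by rewrite mulrC powRrM powR12_sqrt ?pi_ge0// powR_mulrn// sqrtr_ge0.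
have I0 : (0 <= I)%E.
  have n0 r : 0 <= `|r : R| ^+ m by rewrite exprn_ge0.
  by apply: integral_ge0 => r _; rewrite !mule_ge0// lee_fin ?expR_ge0.
rewrite /sphere_area GammaE piE; clear GammaE; move: gaussE I0.
clearbody I; case: I => [r| |] //.
- rewrite -!EFinM => -[E] _ /=; rewrite E.
  have r0 : r != 0 by apply/eqP => r0; move: sp0; rewrite E r0 mulr0 ltxx.
  by field; rewrite r0.
(* [Gamma] only records the finite part of 2 I, so I = +oo must be excluded: C I would then be 0 or
   +oo, whereas the mass of the Gaussian is finite and positive. *)
- move: C0; rewrite le_eqVlt => /predU1P[<-|C0].
    by rewrite mul0e => -[E]; move: sp0; rewrite E ltxx.
  by rewrite gt0_muley.
Qed.

Lemma sphere_area_ge0 m : 0 <= sphere_area m :> R.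
Proof. by rewrite -radial_constantE radial_constant_ge0. Qed.

Lemma ge0_integral_radial m (F : R -> \bar R) :
  measurable_fun setT F -> (forall x, (0 <= F x)%E) ->
  (\int[lebesgue_rV m.+1]_y F (Num.sqrt (sqnorm y)) =
   (sphere_area m)%:E *
   \int[leb]_r ((\1_`]0%R, +oo[ r)%:E * (F r * (`|r| ^+ m)%:E)))%E.
Proof. by rewrite -radial_constantE; exact: ge0_integral_radial_constant. Qed.

End radial.

(** * The distribution of the last coordinate on a sphere *)

Section sphere_slices.
Context {R : realType}.

(** For a point (y', z) of slope w = z / |y'|, the last coordinate of its radial projection to the
    unit sphere is t = [psi] w; conversely w = [phi] t for t in ]-1, 1[. *)
Let phi (x : R) : R := x / Num.sqrt (1 - x ^+ 2).
Let psi (y : R) : R := y / Num.sqrt (1 + y ^+ 2).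
Let I : set R := `]-1, 1[%classic.

Let I_sqr (x : R) : I x <-> x ^+ 2 < 1.
Proof.
rewrite /I/= in_itv/=; split=> [/andP[]|x1]; first by nra.
by apply/andP; split; nra.
Qed.

Let psi_sqrt (y : R) : 0 < Num.sqrt (1 + y ^+ 2).
Proof. by rewrite sqrtr_gt0 ltr_pwDl// sqr_ge0. Qed.

Let phi_sqrt (x : R) : I x -> 0 < Num.sqrt (1 - x ^+ 2).
Proof. by move=> /I_sqr x1; rewrite sqrtr_gt0 subr_gt0. Qed.

Let psiI (y : R) : I (psi y).
Proof.
apply/I_sqr; rewrite /psi expr_div_n sqr_sqrtr; last first.
  by rewrite addr_ge0// sqr_ge0.
by rewrite ltr_pdivrMr ?mul1r ?ltrDr// ltr_pwDl// sqr_ge0.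
Qed.

Let psi_sub (y : R) : 1 - psi y ^+ 2 = (Num.sqrt (1 + y ^+ 2) ^+ 2)^-1.
Proof.
rewrite /psi expr_div_n sqr_sqrtr; last by rewrite addr_ge0// sqr_ge0.
have : 1 + y ^+ 2 != 0 by rewrite gt_eqF// ltr_pwDl// sqr_ge0.
by move=> h; field.
Qed.

Let psiK : cancel psi phi.
Proof.
move=> y; rewrite /phi psi_sub -exprVn sqrtr_sqr gtr0_norm ?invr_gt0// invrK.
by rewrite /psi mulfVK// gt_eqF.
Qed.

Let phi_add (x : R) : I x ->
  Num.sqrt (1 + phi x ^+ 2) = (Num.sqrt (1 - x ^+ 2))^-1.
Proof.
move=> Ix; have s0 := phi_sqrt Ix.
rewrite -[RHS]gtr0_norm ?invr_gt0// -sqrtr_sqr; congr Num.sqrt.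
have : 1 - x ^+ 2 != 0 by rewrite gt_eqF// subr_gt0; apply/I_sqr.
rewrite /phi exprVn expr_div_n sqr_sqrtr; last first.
  by rewrite subr_ge0 ltW//; apply/I_sqr.
by move=> h; field.
Qed.

Let phiK (x : R) : I x -> psi (phi x) = x.
Proof.
move=> Ix; rewrite /psi phi_add// invrK /phi mulfVK//.
by rewrite gt_eqF// phi_sqrt.
Qed.

Let galois (x y : R) : I x -> (phi x <= y) = (x <= psi y).
Proof.
move=> Ix; have s0 := phi_sqrt Ix; have r0 := psi_sqrt y.
rewrite /phi /psi ler_pdivrMr// ler_pdivlMr//.
have sE : Num.sqrt (1 - x ^+ 2) ^+ 2 = 1 - x ^+ 2.
  by rewrite sqr_sqrtr// subr_ge0 ltW//; apply/I_sqr.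
have rE : Num.sqrt (1 + y ^+ 2) ^+ 2 = 1 + y ^+ 2.
  by rewrite sqr_sqrtr// addr_ge0// sqr_ge0.
move: (Num.sqrt (1 - x ^+ 2)) (Num.sqrt (1 + y ^+ 2)) s0 r0 sE rE.
move=> s r s0 r0 sE rE.
(* Squaring preserves the comparison between nonnegative numbers and reverses it between nonpositive
   ones; for opposite signs it is decided without squaring. *)
have [x0|x0] := leP 0 x; have [y0|y0] := leP 0 y.
- rewrite -ler_sqr ?nnegrE ?mulr_ge0 ?(ltW s0)//.
  rewrite -[RHS]ler_sqr ?nnegrE ?mulr_ge0 ?(ltW r0)//.
  by rewrite !exprMn sE rE; apply/idP/idP => h; lra.
- apply/idP/idP => h; first by have := pmulr_llt0 y s0; nra.
  by have := mulr_ge0 x0 (ltW r0); lra.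
- have -> : x <= y * s by rewrite (le_trans (ltW x0))// mulr_ge0// ltW.
  by apply/esym; rewrite (le_trans _ y0)// mulr_le0_ge0// ltW.
- have nx : 0 <= - x by rewrite oppr_ge0 ltW.
  have ny : 0 <= - y by rewrite oppr_ge0 ltW.
  have nys : 0 <= - y * s by rewrite mulr_ge0// ltW.
  have nxr : 0 <= - x * r by rewrite mulr_ge0// ltW.
  have -> : (x <= y * s) = ((- y * s) ^+ 2 <= (- x) ^+ 2).
    by rewrite ler_sqr ?nnegrE// mulNr lerN2.
  have -> : (x * r <= y) = ((- y) ^+ 2 <= (- x * r) ^+ 2).
    by rewrite ler_sqr ?nnegrE// mulNr lerN2.
  by rewrite !exprMn !sqrrN sE rE; apply/idP/idP => h; lra.
Qed.

Let dphi (x : R) : R := (Num.sqrt (1 - x ^+ 2) ^+ 3)^-1.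

Let sqrt_derive (x : R) : I x ->
  is_derive x 1 (fun x : R => Num.sqrt (1 - x ^+ 2)) (- x / Num.sqrt (1 - x ^+ 2)).
Proof.
move=> Ix; have s0 := phi_sqrt Ix.
have h1 : is_derive x 1 (fun x : R => 1 - x ^+ 2) (- (2 * x)).
  rewrite (_ : (fun _ => _) = cst 1 - id ^+ 2); last first.
    by apply/funext => z; rewrite /= !fctE.
  apply: is_derive_eq (is_deriveB (is_derive_cst _ _ _)
    (is_deriveX _ (is_derive_id _ _))) _.
  by rewrite /= sub0r expr1 [X in - X]mulr1.
have p0 : 0 < 1 - x ^+ 2 by rewrite subr_gt0; apply/I_sqr.
have h2 := @is_derive1_comp R Num.sqrt (fun x => 1 - x ^+ 2) x _ _
  (is_derive1_sqrt p0) h1.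
apply: is_derive_eq h2 _.
by field; rewrite gt_eqF.
Qed.

Let phi_derive (x : R) : I x -> is_derive x 1 phi (dphi x).
Proof.
move=> Ix; have s0 := phi_sqrt Ix; have s1 : Num.sqrt (1 - x ^+ 2) != 0.
  by rewrite gt_eqF.
have h := @is_deriveV R (fun x => Num.sqrt (1 - x ^+ 2)) x _ _ s1
  (sqrt_derive Ix).
have h2 := is_deriveM (is_derive_id x 1) h.
apply: is_derive_eq h2 _.
have sE : Num.sqrt (1 - x ^+ 2) ^+ 2 = 1 - x ^+ 2.
  by rewrite sqr_sqrtr// subr_ge0 ltW//; apply/I_sqr.
rewrite /dphi /GRing.scale/=.
move: (Num.sqrt (1 - x ^+ 2)) s1 sE => s s1 sE.
transitivity ((s ^+ 2 + x ^+ 2) / s ^+ 3); first by field.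
by rewrite sE subrK mul1r.
Qed.

Let dphi_continuous (x : R) : I x -> {for x, continuous dphi}.
Proof.
move=> Ix; have s0 := phi_sqrt Ix.
have cs := is_derive_continuous (sqrt_derive Ix).
rewrite /dphi; apply: cvgV; first by rewrite gt_eqF// exprn_gt0.
exact: (continuous_comp cs (@exprn_continuous R 3 _)).
Qed.

Lemma ge0_integral_sqrt_substitution (F : R -> \bar R) :
  measurable_fun setT F -> (forall x, (0 <= F x)%E) ->
  (\int[leb]_y F y = \int[leb]_x ((\1_`]-1, 1[ x)%:E *
    ((dphi x)%:E * F (phi x))))%E.
Proof.
move=> mF F0.
have mphi : measurable_fun setT phi by rewrite /phi; measurability.
have mdphi : measurable_fun setT dphi by rewrite /dphi; measurability.
have Iint a b x : I a -> I b -> a <= x <= b -> I x.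
  rewrite /I/= !in_itv/= => /andP[a1 _] /andP[_ b1] /andP[ax xb].
  by rewrite (lt_le_trans a1)// (le_lt_trans xb).
have dphi0 x : I x -> 0 <= dphi x.
  by move=> Ix; rewrite /dphi invr_ge0 exprn_ge0// ltW// phi_sqrt.
exact: (ge0_integral_substitution (psi := psi)).
Qed.

Definition punctured_ball {m} : set ('rV[R]_m * R) := [set y | 0 < enorm y <= 1].

Lemma enormE m (y : 'rV[R]_m * R) : enorm y = Num.sqrt (sqnorm y.1 + y.2 ^+ 2).
Proof. by []. Qed.

Lemma measurable_enorm m : measurable_fun setT (@enorm R m).
Proof.
have msq := @measurable_sqnorm R m.
rewrite (_ : @enorm R m = (fun y => Num.sqrt (sqnorm y.1 + y.2 ^+ 2)))//.
by measurability.
Qed.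

Lemma measurable_punctured_ball m : measurable (@punctured_ball m).
Proof.
have -> : @punctured_ball m = @enorm R m @^-1` `]0, 1]%classic.
  by apply/seteqP; split => y; rewrite /punctured_ball/= in_itv.
rewrite -[X in measurable X]setTI; exact: measurable_enorm.
Qed.

(** At height z, polar coordinates in R^(m+1) produce [sphere_area m] and r^m dr. With z = r w the
    value of h depends on w alone, so r can be integrated out, and w = [phi] t brings back the
    coordinate t on the sphere S^(m+1). *)
Lemma ge0_integral_slice m (h : R -> \bar R) :
  measurable_fun setT h -> (forall t, (0 <= h t)%E) ->
  (m.+2%:R%:E * \int[lebesgue_rVR m.+1]_y
     ((\1_(@punctured_ball m.+1) y)%:E * h (y.2 / enorm y)%R) =
   (sphere_area m)%:E * \int[leb]_t ((\1_`]-1, 1[ t)%:E *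
     (((1 - t ^+ 2) `^ ((m.+1%:R - 2) / 2))%:E * h t)))%E.
Proof.
move=> mh h0.
have mu1 : measurable_fun [set: R] (\1_(`]0, 1]%classic) : R -> R).
  by apply: measurable_indic; exact: measurable_itv.
have mpos : measurable_fun [set: R] (\1_(`]0, +oo[%classic) : R -> R).
  by apply: measurable_indic; exact: measurable_itv.
have msq := @measurable_sqnorm R m.+1.
pose Phi (z r : R) := ((\1_`]0%R, 1%R] (Num.sqrt (r ^+ 2 + z ^+ 2)))%:E *
  h (z / Num.sqrt (r ^+ 2 + z ^+ 2))%R)%E.
have Phi0 z r : (0 <= Phi z r)%E by rewrite mule_ge0.
have mPhi : measurable_fun setT (fun p : R * R => Phi p.1 p.2).
  by rewrite /Phi; measurability.
have n0 n (r : R) : (0 <= (`|r| ^+ n)%:E)%E by rewrite lee_fin exprn_ge0.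
pose K (w r : R) := (h (psi w) * ((\1_`]0%R, 1%R] (r * Num.sqrt (1 + w ^+ 2)))%:E *
  (`|r| ^+ m.+1)%:E))%E.
have K0 w r : (0 <= K w r)%E by rewrite !mule_ge0.
have mpsi : measurable_fun setT psi by rewrite /psi; measurability.
have mK : measurable_fun setT (fun p : R * R => K p.1 p.2).
  by rewrite /K; measurability.
transitivity (m.+2%:R%:E * \int[leb]_z \int[lebesgue_rV m.+1]_y
    Phi z (Num.sqrt (sqnorm y)))%E.
  congr (_ * _)%E; rewrite ge0_integral_rVR_swap.
  - apply: eq_integral => z _; apply: eq_integral => y _.
    by rewrite /Phi sqr_sqrtr ?sqnorm_ge0.
  - have me := @measurable_enorm m.+1.
    have mB := @measurable_indic _ _ R setT _ (@measurable_punctured_ball m.+1).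
    by measurability.
  - by move=> y; rewrite mule_ge0.
have mG : measurable_fun setT (fun p : R * R =>
    (\1_`]0%R, +oo[ p.2)%:E * (Phi p.1 p.2 * (`|p.2| ^+ m)%:E))%E.
  by measurability.
have G0 z r : (0 <= (\1_`]0%R, +oo[ r)%:E * (Phi z r * (`|r| ^+ m)%:E))%E.
  by rewrite !mule_ge0.
transitivity (m.+2%:R%:E * ((sphere_area m)%:E * \int[leb]_z \int[leb]_r
    ((\1_`]0%R, +oo[ r)%:E * (Phi z r * (`|r| ^+ m)%:E))))%E.
  congr (_ * _)%E; rewrite -ge0_integralZl//; last 3 first.
  - exact: measurable_fun_integral.
  - by move=> z _; apply: integral_ge0.
  - by rewrite lee_fin sphere_area_ge0.
  apply: eq_integral => z _; apply: ge0_integral_radial => //.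
  by rewrite /Phi; measurability.
rewrite muleCA; congr (_ * _)%E.
rewrite ge0_integral_exchange//.
transitivity (m.+2%:R%:E * \int[leb]_r \int[leb]_w K w r)%E.
  congr (_ * _)%E; apply: eq_integral => r _.
  have [r0|r0] := ltP 0 r; last first.
    have rF : \1_`]0%R, +oo[ r = 0 :> R.
      by rewrite indicE memNset//= in_itv/= andbT; apply/negP; rewrite -leNgt.
    transitivity (0%E : \bar R).
      by apply: integral0_eq => z _; rewrite rF mul0e.
    apply/esym; apply: integral0_eq => w _; rewrite /K [\1_`]0%R, 1%R] _]indicE.
    rewrite memNset ?mul0e ?mule0//= in_itv/=; apply/negP; rewrite negb_and.
    by rewrite -leNgt mulr_le0_ge0// ?sqrtr_ge0.
  have mGr : measurable_fun setT (fun z =>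
      (\1_`]0%R, +oo[ r)%:E * (Phi z r * (`|r| ^+ m)%:E))%E.
    by rewrite /Phi; measurability.
  (* Substitution z = r w at fixed r > 0; its Jacobian r raises r^m to the r^(m+1) of [K]. *)
  rewrite (ge0_integral_leb_affine 0 r0 mGr) => [|z]; last exact: G0.
  have mGr' : measurable_fun setT (fun w =>
      (\1_`]0%R, +oo[ r)%:E * (Phi (r * w + 0)%R r * (`|r| ^+ m)%:E))%E.
    by apply: (measurableT_comp mGr); measurability.
  rewrite -ge0_integralZl//; last by rewrite lee_fin ltW.
  apply: eq_integral => w _.
  have q0 := psi_sqrt w.
  have sE : Num.sqrt (r ^+ 2 + (r * w + 0) ^+ 2) = r * Num.sqrt (1 + w ^+ 2).
    rewrite addr0 exprMn -{1}(mulr1 (r ^+ 2)) -mulrDr sqrtrM ?sqr_ge0//.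
    by rewrite sqrtr_sqr gtr0_norm.
  rewrite /Phi /K sE.
  have -> : (r * w + 0) / (r * Num.sqrt (1 + w ^+ 2)) = psi w.
    by rewrite /psi addr0; field; rewrite !gt_eqF.
  have -> : \1_`]0%R, +oo[ r = 1 :> R.
    by rewrite indicE mem_set//= in_itv/= r0.
  rewrite mul1e (exprS _ m) EFinM gtr0_norm//.
  rewrite [X in _ = (_ * X)%E]muleCA [RHS]muleCA; congr (_ * _)%E.
  by rewrite [RHS]muleA (muleC (h _)).
rewrite -ge0_integral_exchange//.
transitivity (\int[leb]_w (h (psi w) *
    ((Num.sqrt (1 + w ^+ 2))^-1 ^+ m.+2)%R%:E))%E.
  rewrite -ge0_integralZl//; last 2 first.
  - exact: measurable_fun_integral.
  - by move=> w _; apply: integral_ge0.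
  apply: eq_integral => w _; have q0 := psi_sqrt w.
  have mi : measurable_fun setT (fun r : R =>
      ((\1_`]0%R, 1%R] (r * Num.sqrt (1 + w ^+ 2)))%:E *
      (`|r| ^+ m.+1)%:E)%E) by measurability.
  have -> : (\int[leb]_r K w r = h (psi w) * \int[leb]_r
     ((\1_`]0%R, 1%R] (r * Num.sqrt (1 + w ^+ 2)))%:E * (`|r| ^+ m.+1)%:E))%E.
    by rewrite -ge0_integralZl// => r _; rewrite mule_ge0.
  rewrite muleCA; congr (_ * _)%E.
  (* The cone condition reads 0 < r <= (1 + w^2)^(-1/2). The primitive of r^(m+1) has the
     denominator m + 2, which the factor in the definition of [sphere_measure] cancels. *)
  transitivity (m.+2%:R%:E * \int[leb]_(r in `]0%R, (Num.sqrt (1 + w ^+ 2))^-1%R])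
     (r ^+ m.+1)%:E)%E.
    congr (_ * _)%E; rewrite [RHS]integral_indicl; apply: eq_integral => r _.
    rewrite !indicE.
    rewrite (_ : (r \in _) =
        (r * Num.sqrt (1 + w ^+ 2) \in `]0, 1]%classic)); last first.
      apply/idP/idP; rewrite !inE/= !in_itv/=.
        by move=> /andP[r0 r1]; rewrite mulr_gt0//= -ler_pdivlMr// div1r.
      by rewrite pmulr_lgt0// -(ler_pdivlMr _ _ q0) div1r.
    case: (boolP (_ \in _)) => [|_]; last by rewrite !mul0e.
    by rewrite inE/= in_itv/= pmulr_lgt0// => /andP[r0 _]; rewrite gtr0_norm.
  rewrite integral_expn ?invr_ge0 ?(ltW q0)// -EFinM; congr (_%:E).
  by rewrite mulrC mulfVK// pnatr_eq0.
rewrite ge0_integral_sqrt_substitution; last 2 first.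
- by measurability.
- by move=> w; rewrite mule_ge0// lee_fin exprn_ge0// invr_ge0 sqrtr_ge0.
apply: eq_integral => t _; rewrite indicE.
case: (boolP (t \in _)) => [|_]; last by rewrite !mul0e.
rewrite inE => It; rewrite !mul1e phiK// phi_add// invrK muleCA muleC.
congr (_ * _)%E; rewrite -EFinM /dphi; congr (_%:E).
have s0 := phi_sqrt It.
have u0 : 0 < 1 - t ^+ 2 by rewrite subr_gt0; apply/I_sqr.
move: (1 - t ^+ 2) u0 => u u0.
(* With u = 1 - t^2, the integral over r contributes u^((m+2)/2) and the Jacobian of [phi]
   contributes u^(-3/2); the exponents add up to (m - 1) / 2. *)
rewrite -powR12_sqrt ?(ltW u0)// -!powR_mulrn ?powR_ge0// -!powRrM mulrC.
rewrite -powRB; last by rewrite (gt_eqF u0) implybT.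
by congr (_ `^ _); rewrite -!natr1; field.
Qed.

End sphere_slices.

(** * Measurable Gram-Schmidt for orthogonal projections *)

Section orthogonal_projections.
Context {R : realType}.

Lemma sqnorm_eq0 m (y : 'rV[R]_m) : (sqnorm y == 0) = (y == 0).
Proof.
apply/idP/idP => [|/eqP ->]; last first.
  by rewrite /sqnorm big1// => i _; rewrite mxE expr0n.
rewrite /sqnorm psumr_eq0 => [|i _]; last exact: sqr_ge0.
move=> /allP y0; apply/eqP/rowP => i; apply/eqP; rewrite mxE.
by have := y0 i (mem_index_enum _); rewrite sqrf_eq0.
Qed.

Definition is_oproj m (P : 'M[R]_m) := P^T = P /\ P *m P = P.

(** A fold of conditionals on [sqnorm], so that measurability in P follows by induction on the list
    of rows. The default 0 is reached only when all rows vanish. *)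
Definition first_row m (P : 'M[R]_m) : 'rV[R]_m :=
  foldr (fun i v => if 0 < sqnorm (row i P) then row i P else v) 0 (enum 'I_m).

Definition first_direction m (P : 'M[R]_m) : 'rV[R]_m :=
  (Num.sqrt (sqnorm (first_row P)))^-1 *: first_row P.

(* Gram-Schmidt on the rows of P, zero rows being skipped. *)
Fixpoint projection_basis k m (P : 'M[R]_m) : 'M[R]_(k, m) :=
  match k return 'M[R]_(k, m) with
  | 0 => 0
  | k'.+1 => col_mx (first_direction P) (projection_basis k'
      (P - (first_direction P)^T *m first_direction P)) : 'M[R]_(1 + k', m)
  end.

Lemma first_row_spec m (P : 'M[R]_m) : P != 0 ->
  exists2 i, first_row P = row i P & 0 < sqnorm (row i P).
Proof.
move=> P0; have [i Pi] : exists i, 0 < sqnorm (row i P).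
  apply: contrapT => /forallNP h; move/eqP: P0; apply.
  apply/row_matrixP => i; rewrite row0; apply/eqP; rewrite -sqnorm_eq0.
  by have /negP := h i; rewrite lt_def sqnorm_ge0 andbT negbK.
have : i \in enum 'I_m by rewrite mem_enum.
rewrite /first_row; elim: (enum 'I_m) => //= j s IHs.
rewrite inE => /predU1P[ij|/IHs is_].
  by rewrite -ij Pi; exists i.
by case: ifPn => // Pj; exists j.
Qed.

Lemma col_mx_orthonormal k m (b : 'rV[R]_m) (B : 'M[R]_(k, m)) :
  b *m b^T = 1%:M -> B *m B^T = 1%:M -> B *m b^T = 0 ->
  col_mx b B *m (col_mx b B)^T = 1%:M /\
  (col_mx b B)^T *m col_mx b B = b^T *m b + B^T *m B.
Proof.
move=> bb BB Bb; split; last by rewrite tr_col_mx mul_row_col.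
rewrite tr_col_mx mul_col_row bb BB Bb.
by rewrite -(trmxK (b *m B^T)) trmx_mul trmxK Bb linear0 -scalar_mx_block.
Qed.

(** A normalized row b of P satisfies b P = b, so P - b^T b is again an orthogonal projection; it
    annihilates b and its trace is smaller by 1. At trace 0 the projection vanishes, because tr P =
    tr (P P^T) is the sum of the squared norms of the rows. *)
Lemma projection_basis_spec k m (P : 'M[R]_m) : is_oproj P -> \tr P = k%:R ->
  projection_basis k P *m (projection_basis k P)^T = 1%:M /\
  (projection_basis k P)^T *m projection_basis k P = P.
Proof.
elim: k P => [|k IHk] P [PT PP] trP.
  split; first by apply/matrixP => -[].
  rewrite /= mulmx0; apply/esym/row_matrixP => i.
  rewrite row0; apply/eqP; rewrite -sqnorm_eq0.
  have trE : \tr P = \sum_j sqnorm (row j P).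
    rewrite -{1}PP -{2}PT /mxtrace; apply: eq_bigr => j _.
    by rewrite !mxE /sqnorm; apply: eq_bigr => l _; rewrite !mxE expr2.
  have : \sum_j sqnorm (row j P) == 0 by rewrite -trE trP.
  rewrite psumr_eq0 => [|j _]; last exact: sqnorm_ge0.
  by move=> /allP /(_ i (mem_index_enum _)).
have P0 : P != 0.
  apply/eqP => P0; move/eqP: trP; rewrite P0 linear0 eq_sym pnatr_eq0.
  by [].
have [i fr ri] := first_row_spec P0.
pose b := first_direction P.
have s0 : Num.sqrt (sqnorm (row i P)) != 0 by rewrite gt_eqF// sqrtr_gt0.
have bb : b *m b^T = 1%:M.
  rewrite [LHS]mx11_scalar; congr (_%:M); rewrite -sqnormE /b /first_direction fr.
  rewrite sqnormZ -{2}(sqr_sqrtr (ltW ri)) exprVn mulVf//.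
  by rewrite expf_neq0.
have bP : b *m P = b.
  by rewrite /b /first_direction fr -scalemxAl -row_mul PP.
have Pb : P *m b^T = b^T by rewrite -{1}PT -trmx_mul bP.
pose Q := P - b^T *m b.
have bQ : b *m Q = 0 by rewrite /Q mulmxBr bP mulmxA bb mul1mx subrr.
have Qoproj : is_oproj Q.
  split; first by rewrite /Q linearB/= PT trmx_mul trmxK.
  by rewrite {1}/Q mulmxBl -mulmxA bQ mulmx0 subr0 /Q mulmxBr PP mulmxA Pb.
have trQ : \tr Q = k%:R.
  by rewrite /Q linearB/= trP mxtrace_mulC bb mxtrace1 -natr1 addrK.
have [BB BQ] := IHk Q Qoproj trQ.
rewrite /= -/b -/Q; set B := projection_basis k Q in BB BQ *.
have Bb : B *m b^T = 0.
  rewrite -[B]mul1mx -BB -(mulmxA B) BQ -(mulmxA B).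
  by rewrite -(trmxK (Q *m b^T)) trmx_mul trmxK (proj1 Qoproj) bQ linear0 mulmx0.
have [h1 h2] := col_mx_orthonormal bb BB Bb.
split; first exact: h1.
by apply: (etrans h2); rewrite BQ addrC subrK.
Qed.

Lemma measurable_fun_col_mx d (T : measurableType d) p q m (D : set T)
    (f : T -> 'M[R]_(p, m)) (g : T -> 'M[R]_(q, m)) :
  measurable_fun D f -> measurable_fun D g ->
  measurable_fun D (fun x => col_mx (f x) (g x)).
Proof.
move=> mf mg; apply: measurable_fun_mx => i j; case: (splitP i) => l il.
- rewrite (_ : (fun _ => _) = (fun x => f x l j)).
    exact: measurable_fun_mx_entry.
  apply/funext => x; rewrite (_ : i = lshift q l) ?col_mxEu//.
  exact/val_inj.
- rewrite (_ : (fun _ => _) = (fun x => g x l j)).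
    exact: measurable_fun_mx_entry.
  apply/funext => x; rewrite (_ : i = rshift p l) ?col_mxEd//.
  exact/val_inj.
Qed.

Lemma measurable_first_row m : measurable_fun setT (@first_row m).
Proof.
rewrite /first_row; elim: (enum 'I_m) => [|i s IHs] /=.
  exact: measurable_cst.
have mrow : measurable_fun setT (fun P : 'M[R]_m => row i P).
  apply: measurable_fun_mx => a j; under eq_fun do rewrite mxE.
  exact: measurable_mx_entry.
apply: measurable_fun_ifT => //.
apply: measurable_fun_ltr => //.
exact: (measurableT_comp (@measurable_sqnorm R m)).
Qed.

Lemma measurable_first_direction m : measurable_fun setT (@first_direction m).
Proof.
have mf := @measurable_first_row m; have msq := @measurable_sqnorm R m.
by rewrite /first_direction; measurability.
Qed.

Lemma measurable_projection_basis k m :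
  measurable_fun setT (@projection_basis k m).
Proof.
elim: k => [|k IHk] /=; first exact: measurable_cst.
have mf := @measurable_first_direction m.
have mB : measurable_fun setT (fun P : 'M[R]_m => projection_basis k
    (P - (first_direction P)^T *m first_direction P)).
  apply: (measurableT_comp IHk); apply: measurable_fun_addmx => //.
  apply: measurable_fun_oppmx; apply: measurable_fun_mulmx => //.
  exact: measurable_fun_trmx.
exact: (measurable_fun_col_mx mf mB).
Qed.

End orthogonal_projections.

(** * Projections and orthonormal bases of subspaces *)

Section subspace_projections.
Context {R : realType} {m : nat}.
Implicit Types xi : {vspace 'rV[R]_m}.

Definition oproj_spec xi (P : 'M[R]_m) :=
  [/\ P^T = P, P *m P = P & forall y : 'rV_m, (y \in xi) = (y *m P == y)].

Definition basis_spec k xi (B : 'M[R]_(k, m)) :=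
  B *m B^T = 1%:M /\ forall y : 'rV_m, (y \in xi) = (y <= B)%MS.

(** Each projection fixes the rows of the other, so P Q = P and Q P = Q; transposing the first gives
    Q P = P. *)
Lemma oproj_spec_unique xi (P Q : 'M[R]_m) :
  oproj_spec xi P -> oproj_spec xi Q -> P = Q.
Proof.
move=> [PT PP xiP] [QT QQ xiQ].
have PQ : P *m Q = P.
  apply/row_matrixP => i; rewrite row_mul; apply/eqP; rewrite -xiQ xiP.
  by rewrite -row_mul PP.
have QP : Q *m P = Q.
  apply/row_matrixP => i; rewrite row_mul; apply/eqP; rewrite -xiP xiQ.
  by rewrite -row_mul QQ.
by rewrite -PT -PQ trmx_mul PT QT QP.
Qed.

Let row_basis xi : 'M[R]_(\dim xi, m) := \matrix_i (vbasis xi)`_i.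

Let mem_row_basis xi (y : 'rV_m) : (y \in xi) = (y <= row_basis xi)%MS.
Proof.
apply/idP/idP => [/coord_vbasis ->|/submxP[w ->]].
  apply/submxP; exists (\row_i coord (vbasis xi) i y).
  by rewrite mulmx_sum_row; apply: eq_bigr => i _; rewrite mxE rowK.
rewrite mulmx_sum_row; apply: memv_suml => i _; rewrite rowK; apply: memvZ.
by apply: vbasis_mem; apply: mem_nth; rewrite size_tuple.
Qed.

Let row_basis_inj xi (w : 'rV_(\dim xi)) : w *m row_basis xi = 0 -> w = 0.
Proof.
rewrite mulmx_sum_row => w0; apply/rowP => i; rewrite mxE.
have /freeP := basis_free (vbasisP xi); apply.
by rewrite -[RHS]w0; apply: eq_bigr => j _; rewrite rowK.
Qed.

(** If w A A^T = 0 then |w A|^2 = 0, and w = 0 because the rows of A are free. *)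
Let gram_unit xi : row_basis xi *m (row_basis xi)^T \in unitmx.
Proof.
rewrite -row_free_unit -kermx_eq0; apply/eqP/row_matrixP => i.
rewrite row0; set w := row i _; apply: row_basis_inj.
have wG : w *m (row_basis xi *m (row_basis xi)^T) = 0.
  by rewrite /w -row_mul mulmx_ker row0.
rewrite mulmxA in wG; apply/eqP; rewrite -sqnorm_eq0.
by rewrite sqnormE trmx_mul mulmxA wG mul0mx mxE.
Qed.

(** The classical formula for the projection onto the row space. It is the witness showing that the
    [xget] in [oproj] does not fall back on its default. *)
Let gram_projection xi : 'M[R]_m :=
  (row_basis xi)^T *m invmx (row_basis xi *m (row_basis xi)^T) *m row_basis xi.

Let gram_projection_spec xi : oproj_spec xi (gram_projection xi).
Proof.
rewrite /gram_projection; set A := row_basis xi; have Gu := gram_unit xi.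
rewrite -/A in Gu; set G := A *m A^T in Gu *.
have GT : G^T = G by rewrite /G trmx_mul trmxK.
have APA : A *m (A^T *m invmx G *m A) = A.
  by rewrite !mulmxA -/G mulmxV// mul1mx.
split.
- by rewrite !trmx_mul trmxK trmx_inv GT mulmxA.
- by rewrite -(mulmxA (A^T *m invmx G) A) APA.
- move=> y; rewrite mem_row_basis -/A; apply/idP/eqP.
    by move=> /submxP[w ->]; rewrite -(mulmxA w A) APA.
  by move=> <-; rewrite mulmxA submxMl.
Qed.

Lemma oprojP xi : oproj_spec xi (oproj xi).
Proof.
have := @xgetPex _ 0 [set P : 'M[R]_m | oproj_spec xi P].
by apply; exists (gram_projection xi); exact: gram_projection_spec.
Qed.

Lemma oproj_is_oproj xi : is_oproj (oproj xi).
Proof. by have [] := oprojP xi. Qed.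

Lemma trace_oproj xi : \tr (oproj xi) = (\dim xi)%:R.
Proof.
rewrite (oproj_spec_unique (oprojP xi) (gram_projection_spec xi)).
rewrite /gram_projection mxtrace_mulC mulmxA mulmxV ?gram_unit//.
by rewrite mxtrace1.
Qed.

(** The measurable substitute for the arbitrary choice in [orthonormal_basis]; it also witnesses
    that this choice is not the default 0 when xi has dimension k. *)
Definition selected_basis k (xi : lin_subspace R m) : 'M[R]_(k, m) :=
  projection_basis k (oproj xi).

Lemma basis_of_projection k xi (B : 'M[R]_(k, m)) :
  B *m B^T = 1%:M -> B^T *m B = oproj xi -> basis_spec xi B.
Proof.
move=> BB BP; split => // y; have [_ _ ->] := oprojP xi; rewrite -BP.
apply/eqP/idP => [<-|/submxP[w ->]]; first by rewrite mulmxA submxMl.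
by rewrite -mulmxA (mulmxA B) BB mul1mx.
Qed.

Lemma selected_basisP k xi : \dim xi = k -> basis_spec xi (selected_basis k xi).
Proof.
move=> dk; have trk : \tr (oproj xi) = k%:R by rewrite trace_oproj dk.
have [BB BP] := projection_basis_spec (oproj_is_oproj xi) trk.
exact: basis_of_projection.
Qed.

Lemma orthonormal_basisP k xi : \dim xi = k ->
  basis_spec xi (orthonormal_basis k xi).
Proof.
move=> dk; have := @xgetPex _ 0 [set B : 'M[R]_(k, m) | basis_spec xi B].
by apply; exists (selected_basis k xi); exact: selected_basisP.
Qed.

(** The rows of C lie in the row space of B, which B^T B fixes; hence C = (C B^T) B, and
    orthonormality of C passes to C B^T. *)
Lemma basis_spec_rotation k xi (B C : 'M[R]_(k, m)) :
  basis_spec xi B -> basis_spec xi C ->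
  exists2 O : 'M[R]_k, O *m O^T = 1%:M & C = O *m B.
Proof.
move=> [BB xiB] [CC xiC]; exists (C *m B^T).
  have CBB : C *m B^T *m B = C.
    apply/row_matrixP => i; rewrite !row_mul.
    have : (row i C <= B)%MS by rewrite -xiB xiC row_sub.
    by move=> /submxP[w ->]; rewrite -!mulmxA (mulmxA B) BB mul1mx.
  by rewrite trmx_mul trmxK mulmxA CBB.
apply/row_matrixP => i; rewrite !row_mul.
have : (row i C <= B)%MS by rewrite -xiB xiC row_sub.
by move=> /submxP[w ->]; rewrite -!mulmxA (mulmxA B) BB mul1mx.
Qed.

Lemma measurable_oproj : measurable_fun setT (@oproj R m).
Proof. by move=> _ B mB; exists B. Qed.

Lemma measurable_selected_basis k : measurable_fun setT (selected_basis k).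
Proof.
exact: (measurableT_comp (@measurable_projection_basis R k m) measurable_oproj).
Qed.

(** The dimension is the trace of the projection, a measurable function of it. *)
Lemma measurable_grassmannian k : measurable (@grassmannian R m k).
Proof.
have mtr : measurable_fun setT (fun xi : lin_subspace R m => \tr (oproj xi)).
  rewrite /mxtrace; apply: measurable_sum => i.
  exact: (measurable_fun_mx_entry _ _ measurable_oproj).
have -> : @grassmannian R m k = (fun xi => \tr (oproj xi)) @^-1` [set k%:R].
  apply/seteqP; split => xi; rewrite /grassmannian/= trace_oproj.
    by move=> ->.
  by move=> /eqP; rewrite eqr_nat => /eqP.
by rewrite -[X in measurable X]setTI; apply: mtr.
Qed.

End subspace_projections.

(** * Integration over the spheres S^k_xi *)

Section subsphere_integrals.
Context {R : realType} {m k : nat}.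
Implicit Types xi : {vspace 'rV[R]_m}.

Definition sphere_chart (B : 'M[R]_(k, m)) (y : 'rV[R]_k * R) : 'rV[R]_m * R :=
  ((enorm y)^-1 *: y.1 *m B, (enorm y)^-1 * y.2).

Lemma measurable_sphere_chart (B : 'M[R]_(k, m)) :
  measurable_fun setT (sphere_chart B).
Proof. by have me := @measurable_enorm R k; rewrite /sphere_chart; measurability. Qed.

(** The cone form of [sphere_measure], recast with [mscale] and [mrestr]: its image under the radial
    projection followed by the isometry is visibly a measure. *)
Let ball_measure : set ('rV[R]_k * R) -> \bar R :=
  mscale (NngNum (ler0n R k.+1))
    (mrestr (lebesgue_rVR k) (@measurable_punctured_ball R k)).

Let subsphere_measureE xi :
  subsphere_measure k xi =
  pushforward ball_measure (sphere_chart (orthonormal_basis k xi)).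
Proof.
apply/funext => A; rewrite /subsphere_measure /pushforward /sphere_measure.
rewrite /ball_measure /mscale /mrestr /=; congr (_ * lebesgue_rVR k _)%E.
by apply/seteqP; split => y /= []; split.
Qed.

Let subsphere_measure0 xi : subsphere_measure k xi set0 = 0%E.
Proof.
by rewrite subsphere_measureE /pushforward preimage_set0 /ball_measure measure0.
Qed.

Let subsphere_measure_ge0 xi A : (0 <= subsphere_measure k xi A)%E.
Proof.
by rewrite subsphere_measureE /pushforward /ball_measure measure_ge0.
Qed.

Let subsphere_measure_sigma_additive xi :
  semi_sigma_additive (subsphere_measure k xi).
Proof.
rewrite subsphere_measureE /ball_measure.
have mc := measurable_sphere_chart (orthonormal_basis k xi).
exact: (@measure_semi_sigma_additive _ _ _
  (measure_function_pushforward__canonical__measure_function_Measure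
     (mscale (NngNum (ler0n R k.+1))
    (mrestr (lebesgue_rVR k) (@measurable_punctured_ball R k))) mc)).
Qed.

HB.instance Definition _ xi := isMeasure.Build _ _ _
  (@subsphere_measure R m k xi) (subsphere_measure0 xi)
  (subsphere_measure_ge0 xi) (@subsphere_measure_sigma_additive xi).

(** Membership of y in xi is the vanishing of |y P - y|^2 for the projection P, a measurable
    condition. *)
Lemma measurable_subsphere xi : measurable (subsphere xi).
Proof.
have me := @measurable_enorm R m; have msq := @measurable_sqnorm R m.
have -> : subsphere xi = (@enorm R m @^-1` [set 1]) `&`
    ((fun theta : 'rV[R]_m * R =>
        sqnorm (theta.1 *m oproj xi - theta.1)) @^-1` [set 0]).
  have [_ _ xiP] := oprojP xi.
  apply/seteqP; split => theta /= [e1 h]; split => //.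
    by apply/eqP; rewrite sqnorm_eq0 subr_eq0 -xiP.
  by rewrite xiP -subr_eq0 -sqnorm_eq0 h.
apply: measurableI; rewrite -[X in measurable X]setTI; first exact: me.
have mf : measurable_fun setT (fun theta : 'rV[R]_m * R =>
    sqnorm (theta.1 *m oproj xi - theta.1)) by measurability.
exact: mf.
Qed.

Lemma enorm_mulmx (B : 'M[R]_(k, m)) (y : 'rV[R]_k * R) :
  B *m B^T = 1%:M -> enorm (y.1 *m B, y.2) = enorm y.
Proof. by move=> BB; rewrite !enormE sqnorm_mulmx. Qed.

Lemma enormZ p (c : R) (y : 'rV[R]_p * R) :
  enorm (c *: y.1, c * y.2) = `|c| * enorm y.
Proof.
rewrite !enormE/= sqnormZ exprMn -mulrDr sqrtrM ?sqr_ge0//.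
by rewrite sqrtr_sqr.
Qed.

Lemma sphere_chart_subsphere (B : 'M[R]_(k, m)) xi y : basis_spec xi B ->
  punctured_ball y -> subsphere xi (sphere_chart B y).
Proof.
move=> [BB xiB] /andP[y0 _]; rewrite /sphere_chart; split.
  have := @enorm_mulmx B ((enorm y)^-1 *: y.1, (enorm y)^-1 * y.2) BB.
  by rewrite /= => ->; rewrite enormZ gtr0_norm ?invr_gt0// mulVf// gt_eqF.
by rewrite /= xiB submxMl.
Qed.

Let ge0_integral_subsphere0 xi (F : 'rV[R]_m * R -> \bar R) : \dim xi = k ->
  measurable_fun setT F -> (forall theta, (0 <= F theta)%E) ->
  (\int[subsphere_measure k xi]_(theta in subsphere xi) F theta =
   k.+1%:R%:E * \int[lebesgue_rVR k]_y ((\1_punctured_ball y)%:E *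
     F (sphere_chart (orthonormal_basis k xi) y)))%E.
Proof.
move=> dk mF F0.
have mS := @measurable_indic _ _ R setT _ (measurable_subsphere xi).
have mB := @measurable_indic _ _ R setT _ (@measurable_punctured_ball R k).
have mc := measurable_sphere_chart (orthonormal_basis k xi).
rewrite integral_indicl.
pose w (y : 'rV[R]_k * R) : \bar R := (k.+1%:R%:E * (\1_punctured_ball y)%:E)%E.
have w0 y : (0 <= w y)%E by rewrite /w mule_ge0// lee_fin.
have mw : measurable_fun setT w by rewrite /w; measurability.
rewrite (@integral_eq_measure R _ _ _ (weighted_pushforward
    (lebesgue_rVR k) w (sphere_chart (orthonormal_basis k xi)))); last first.
  move=> A mA; rewrite [LHS](congr1 (fun mu => mu A) (subsphere_measureE xi)).
  have mcA : measurable (sphere_chart (orthonormal_basis k xi) @^-1` A).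
    by rewrite -[X in measurable X]setTI; exact: mc.
  transitivity (\int[lebesgue_rVR k]_(y in
      sphere_chart (orthonormal_basis k xi) @^-1` A) w y)%E => //.
  rewrite /w ge0_integralZl//; last by apply: measurable_funTS; measurability.
  rewrite integral_indic; [by rewrite setIC|exact: mcA|].
  exact: measurable_punctured_ball.
rewrite ge0_integral_weighted_pushforward//; last 2 first.
- by measurability.
- by move=> y; rewrite mule_ge0.
rewrite -ge0_integralZl//; last 2 first.
- by measurability.
- by move=> y _; rewrite mule_ge0.
apply: eq_integral => y _; rewrite /w [LHS]muleC -[LHS]muleA; congr (_ * _)%E.
rewrite [\1_punctured_ball y]indicE.
case: (boolP (y \in _)) => [|_]; last by rewrite !mul0e.
rewrite inE => yB; rewrite indicE mem_set ?mul1e//.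
by apply: sphere_chart_subsphere => //; exact: orthonormal_basisP.
Qed.

(** The chosen basis is W B with W orthogonal. Replacing y' by y' W preserves both the norm and
    Lebesgue measure, so any orthonormal basis gives the same integral. *)
Lemma ge0_integral_subsphere xi (B : 'M[R]_(k, m))
    (F : 'rV[R]_m * R -> \bar R) : \dim xi = k -> basis_spec xi B ->
  measurable_fun setT F -> (forall theta, (0 <= F theta)%E) ->
  (\int[subsphere_measure k xi]_(theta in subsphere xi) F theta =
   k.+1%:R%:E * \int[lebesgue_rVR k]_y ((\1_punctured_ball y)%:E *
     F (sphere_chart B y)))%E.
Proof.
move=> dk xiB mF F0; rewrite ge0_integral_subsphere0//; congr (_ * _)%E.
have [W WW ->] := basis_spec_rotation xiB (orthonormal_basisP dk).
have mB := @measurable_indic _ _ R setT _ (@measurable_punctured_ball R k).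
have mc := measurable_sphere_chart B.
have mc' := measurable_sphere_chart (W *m B).
have mG : measurable_fun setT (fun y => (\1_punctured_ball y)%:E *
    F (sphere_chart B y))%E by measurability.
have G0 y : (0 <= (\1_punctured_ball y)%:E * F (sphere_chart B y))%E.
  by rewrite mule_ge0.
have mG' : measurable_fun setT (fun y => (\1_punctured_ball y)%:E *
    F (sphere_chart (W *m B) y))%E by measurability.
have G'0 y : (0 <= (\1_punctured_ball y)%:E * F (sphere_chart (W *m B) y))%E.
  by rewrite mule_ge0.
(* The last coordinate is frozen first, because W acts on R^k alone. *)
rewrite (ge0_integral_rVR_swap mG G0) (ge0_integral_rVR_swap mG' G'0).
apply: eq_integral => t _.
have mGt : measurable_fun setT (fun y => (\1_punctured_ball (y, t))%:E *
    F (sphere_chart B (y, t)))%E.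
  by apply: (measurableT_comp mG); measurability.
rewrite -(ge0_integral_rV_rotation WW mGt (fun y => G0 (y, t))).
apply: eq_integral => y _.
have eE : enorm (y *m W, t) = enorm (y, t) by rewrite !enormE/= sqnorm_mulmx.
have bE : ((y *m W, t) \in @punctured_ball R k) = ((y, t) \in punctured_ball).
  by apply/idP/idP; rewrite !inE /punctured_ball/= eE.
by rewrite /= !indicE bE /sphere_chart eE/= -!scalemxAl mulmxA.
Qed.

End subsphere_integrals.

Lemma c_v_ge0 (R : realType) k : 0 <= c_v k.+1 :> R.
Proof.
rewrite /c_v; apply: mulr_ge0; last by rewrite invr_ge0 sphere_area_ge0.
by apply: mulr_ge0; [exact: powR_ge0 | exact: sphere_area_ge0].
Qed.

(** * The right-hand side for nonnegative Borel integrands *)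

Section reduced_integral.
Context {R : realType} (m k : nat).
Variable F : 'rV[R]_m * R -> R -> R.
Hypothesis mF : measurable_fun setT (fun p : ('rV[R]_m * R) * R => F p.1 p.2).
Hypothesis F0 : forall y t, 0 <= F y t.

(** The subspaces have dimension [k.+1] from here on; [e] is the exponent both of the slice density
    on S^(k+1) and of the kernel of [v]. *)
Let e : R := (k.+1%:R - 2) / 2.

(** In the model case F y t = f y * u t, the function f is taken at height s and u at t. *)
Definition slab_integral (s t : R) : \bar R :=
  (\int[lebesgue_rV m]_x (F (x, s) t)%:E)%E.

(* Both sides of the duality, after integrating out the translations x' and the
   directions transversal to e_n. *)
Definition reduced_integral : \bar R :=
  (\int[leb]_t ((\1_`]0%R, +oo[ t)%:E *
    ((sphere_area k / sphere_area k.+1)%:E *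
     \int[leb]_r ((\1_`]-1, 1[ r)%:E * (((1 - r ^+ 2) `^ e)%:E *
       slab_integral (t + t * r)%R t)))))%E.

Lemma slab_integral_ge0 s t : (0 <= slab_integral s t)%E.
Proof. by apply: integral_ge0 => x _; rewrite lee_fin. Qed.

Lemma measurable_slab_integral :
  measurable_fun setT (fun p : R * R => slab_integral p.1 p.2).
Proof.
rewrite /slab_integral.
apply: (@measurable_fun_integral _ _ (R * R)%type _ _ (lebesgue_rV m)
  (fun p x => (F (x, p.1) p.2)%:E)).
- apply/measurable_EFinP.
  by apply: (measurableT_comp mF (g := fun q : (R * R) * 'rV[R]_m =>
    ((q.2, q.1.1), q.1.2))); measurability.
- by move=> p x; rewrite lee_fin.
Qed.

Let c : R := c_v k.+1.

Let c0 : 0 <= c. Proof. exact: c_v_ge0. Qed.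

(** The kernel of [v] on the whole plane: the indicators encode s > 0 and t > s / 2, and the
    absolute value keeps it nonnegative everywhere. *)
Let H (s t : R) : R := \1_`]0%R, +oo[ s * \1_`]0%R, +oo[ (t - s / 2) *
  (c * s `^ e * (t - s / 2) `^ e / `|t| ^+ k).

Let H0 s t : 0 <= H s t.
Proof.
rewrite /H; apply: mulr_ge0; first by rewrite mulr_ge0.
apply: mulr_ge0; last by rewrite invr_ge0 exprn_ge0.
by apply: mulr_ge0 (powR_ge0 _ _); apply: mulr_ge0 c0 (powR_ge0 _ _).
Qed.

Let mpos : measurable_fun [set: R] (\1_(`]0, +oo[%classic) : R -> R).
Proof. by apply: measurable_indic; exact: measurable_itv. Qed.

Let mH : measurable_fun setT (fun p : R * R => H p.1 p.2).
Proof. by have := mpos => ?; rewrite /H; measurability. Qed.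

Let v_kernel (x : 'rV[R]_m * R) : 0 < x.2 ->
  (v k.+1 (F x) x.2 = \int[leb]_t ((H x.2 t)%:E * (F x t)%:E))%E.
Proof.
move=> s0; rewrite /v integral_leb integral_indicl -/c -/e.
have mFx : measurable_fun setT (F x).
  by apply: (measurableT_comp mF (g := fun t : R => (x, t))); measurability.
have mi : measurable_fun [set: R] (\1_(`](x.2 / 2), +oo[%classic) : R -> R).
  by apply: measurable_indic; exact: measurable_itv.
have tpos t : t \in (`](x.2 / 2), +oo[%classic : set R) -> 0 < t.
  rewrite inE/= in_itv/= andbT; apply: lt_trans.
  by rewrite divr_gt0.
have mf : measurable_fun setT (fun t => (\1_`](x.2 / 2)%R, +oo[ t)%:E *
    (F x t * (t - x.2 / 2) `^ ((k.+1%:R - 2) / 2) / t ^+ k)%:E)%E.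
  by measurability.
rewrite -(ge0_integralZl _ _ mf)//.
- apply: eq_integral => t _; rewrite /H.
  have -> : \1_`]0%R, +oo[ x.2 = 1 :> R.
    by rewrite indicE mem_set//= in_itv/= s0.
  have -> : \1_`]0, +oo[ (t - x.2 / 2) = \1_`](x.2 / 2), +oo[ t :> R.
    rewrite !indicE; congr (nat_of_bool _)%:R; apply/idP/idP;
      by rewrite !inE/= !in_itv/= !andbT subr_gt0.
  rewrite !indicE; case: (boolP (_ \in _)) => [/tpos t0|_]; last first.
    by rewrite !(mul0e, mule0, mulr0, mul0r).
  rewrite -!EFinM gtr0_norm// !mul1r; congr (_%:E).
  by rewrite -/e; move: (t ^+ k)^-1 => b; ring.
- move=> t _; rewrite indicE; case: (boolP (_ \in _)) => [/tpos t0|_].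
    rewrite mul1e lee_fin; apply: mulr_ge0.
      by apply: mulr_ge0 (powR_ge0 _ _); exact: F0.
    by rewrite invr_ge0 exprn_ge0// ltW.
  by rewrite mul0e.
- by rewrite lee_fin mulr_ge0// powR_ge0.
Qed.

(** For s = t (1 + r) one has s (t - s/2) = t^2 (1 - r^2) / 2. The Jacobian t and t^(2e) cancel t^k
    since 2e + 1 = k, and the power of 2 in [c_v] cancels 2^(-e): this explains the exponents and
    the constant in [v]. *)
Let kernel_scale (t r : R) : 0 < t -> t * H (t * r + t) t =
  \1_`]-1, 1[ r * (sphere_area k / sphere_area k.+1 * (1 - r ^+ 2) `^ e).
Proof.
move=> t0; rewrite /H.
have E1 : t * r + t = t * (1 + r) by ring.
have E2 : t - (t * r + t) / 2 = t * ((1 - r) / 2) by field.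
rewrite E2 E1 !indicE.
have -> : (t * (1 + r) \in (`]0, +oo[%classic : set R)) = (-1 < r).
  by apply/idP/idP; rewrite !inE/= in_itv/= andbT pmulr_rgt0// -ltrBlDl sub0r.
have -> : (t * ((1 - r) / 2) \in (`]0, +oo[%classic : set R)) = (r < 1).
  by apply/idP/idP; rewrite !inE/= in_itv/= andbT pmulr_rgt0//
    pmulr_lgt0 ?invr_gt0// subr_gt0.
have -> : (r \in (`]-1, 1[%classic : set R)) = (-1 < r) && (r < 1).
  by apply/idP/idP; rewrite !inE/= in_itv.
case: ltP => r1; case: ltP => r2 /=; rewrite ?(mul0r, mulr0)// !mul1r.
have p1 : 0 < 1 + r by lra.
have p2 : 0 < 1 - r by lra.
rewrite gtr0_norm// !powRM ?(ltW t0) ?(ltW p1) ?(ltW p2) ?invr_ge0//.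
rewrite (_ : 1 - r ^+ 2 = (1 + r) * (1 - r)); last by ring.
rewrite powRM ?(ltW p1) ?(ltW p2)// -powR_inv1// -(powRrM _ (-1)) mulN1r powRN.
have te : t * (t `^ e * t `^ e) = t ^+ k.
  rewrite -powRD ?(gt_eqF t0) ?implybT// -{1}(powRr1 (ltW t0)).
  rewrite -powRD ?(gt_eqF t0) ?implybT// -powR_mulrn ?(ltW t0)//.
  by congr (_ `^ _); rewrite /e -natr1; field.
have tk0 : t ^+ k != 0 by rewrite gt_eqF// exprn_gt0.
have e2 : (2 : R) `^ e != 0 by rewrite gt_eqF// powR_gt0.
rewrite /c /c_v -/e; move: te tk0 e2 p1 p2.
move: (t `^ e) (t ^+ k) ((2 : R) `^ e) => a b d ab b0 d0 p1 p2.
rewrite -ab in b0 *.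
  rewrite /=; move: (sphere_area k.+1)^-1 => q.
  move: b0; rewrite !mulf_eq0 !negb_or => /andP[t1 /andP[a1 _]].
  by field; rewrite t1 a1 d0.
by rewrite divr_ge0// ltW.
Qed.

Let mHF : measurable_fun setT
  (fun p : ('rV[R]_m * R) * R => (H p.1.2 p.2)%:E * (F p.1 p.2)%:E)%E.
Proof.
apply: emeasurable_funM; apply/measurable_EFinP => //.
by apply: (measurableT_comp mH (g := fun p : ('rV[R]_m * R) * R =>
  (p.1.2, p.2))); measurability.
Qed.

Let HF0 x t : (0 <= (H x.2 t)%:E * (F x t)%:E)%E.
Proof. by rewrite mule_ge0 ?lee_fin. Qed.

Let mint : measurable_fun setT
  (fun x : 'rV[R]_m * R => \int[leb]_t ((H x.2 t)%:E * (F x t)%:E))%E.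
Proof. exact: measurable_fun_integral mHF HF0. Qed.

Lemma measurable_v :
  measurable_fun (@half_space R m) (fun x => v k.+1 (F x) x.2).
Proof.
have := measurable_funTS mint (D := @half_space R m).
by apply: eq_measurable_fun => x; rewrite inE => x0; rewrite v_kernel.
Qed.

Lemma v_ge0 x : 0 < x.2 -> (0 <= v k.+1 (F x) x.2)%E.
Proof. by move=> x0; rewrite v_kernel//; apply: integral_ge0. Qed.

(** Tonelli's theorem moves x' inside, where it produces [slab_integral], and t outside; at fixed t
    > 0 the substitution in s is affine. *)
Lemma rhs_integralE : rhs_integral k.+1 F = reduced_integral.
Proof.
transitivity (\int[lebesgue_rVR m]_x \int[leb]_t ((H x.2 t)%:E * (F x t)%:E))%E.
  rewrite /rhs_integral integral_indicl; apply: eq_integral => x _.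
  rewrite indicE; case: (boolP (x \in _)) => [|xh].
    by rewrite inE /half_space/= => x0; rewrite mul1e v_kernel.
  rewrite mul0e; apply/esym; apply: integral0_eq => t _; rewrite /H.
  rewrite (_ : \1_`]0%R, +oo[ x.2 = 0) ?mul0r ?mul0e// indicE memNset//=.
  rewrite in_itv/= andbT; apply/negP; apply: contra xh.
  by rewrite inE.
have int0 x : (0 <= \int[leb]_t ((H x.2 t)%:E * (F x t)%:E))%E.
  by apply: integral_ge0.
rewrite (ge0_integral_rVR_swap mint int0).
have mG := measurable_slab_integral.
have mHG : measurable_fun setT (fun p : R * R =>
    (H p.1 p.2)%:E * slab_integral p.1 p.2)%E.
  by apply: emeasurable_funM => //; apply/measurable_EFinP.
have HG0 s t : (0 <= (H s t)%:E * slab_integral s t)%E.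
  by rewrite mule_ge0 ?lee_fin ?slab_integral_ge0.
transitivity (\int[leb]_s \int[leb]_t ((H s t)%:E * slab_integral s t))%E.
  apply: eq_integral => s _.
  have mE : measurable_fun setT (fun p : 'rV[R]_m * R =>
      ((H s p.2)%:E * (F (p.1, s) p.2)%:E)%E).
    by apply: (measurableT_comp mHF (g := fun p : 'rV[R]_m * R =>
      ((p.1, s), p.2))); measurability.
  rewrite (ge0_integral_exchange _ _ mE) => [|x t]; last exact: (HF0 (x, s)).
  apply: eq_integral => t _.
  have mFt : measurable_fun setT (fun x : 'rV[R]_m => (F (x, s) t)%:E).
    apply/measurable_EFinP.
    by apply: (measurableT_comp mF (g := fun x : 'rV[R]_m => ((x, s), t)));
      measurability.
  rewrite /slab_integral -(ge0_integralZl _ _ mFt)//.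
  - by move=> x _; rewrite lee_fin.
  - by rewrite lee_fin.
transitivity (\int[leb]_t \int[leb]_s ((H s t)%:E * slab_integral s t))%E.
  exact: (ge0_integral_exchange _ _ mHG HG0).
apply: eq_integral => t _.
rewrite [\1_`]0%R, +oo[ t]indicE; case: (boolP (t \in _)) => [|tN].
  rewrite inE/= in_itv/= andbT => t0; rewrite mul1e.
  have mt : measurable_fun setT (fun s => (H s t)%:E * slab_integral s t)%E.
    by apply: (measurableT_comp mHG (g := fun s : R => (s, t))); measurability.
  rewrite (ge0_integral_leb_affine t t0 mt) => [|s]; last exact: HG0.
  have mt' : measurable_fun setT (fun s =>
      (H (t * s + t)%R t)%:E * slab_integral (t * s + t)%R t)%E.
    by apply: (measurableT_comp mt (g := fun s : R => t * s + t)); measurability.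
  rewrite -(ge0_integralZl _ _ mt')//; last by rewrite lee_fin ltW.
  have mI : measurable_fun [set: R] (\1_(`]-1, 1[%classic) : R -> R).
    by apply: measurable_indic; exact: measurable_itv.
  have mK : measurable_fun setT (fun r : R => ((\1_`]-1, 1[ r)%:E *
      (((1 - r ^+ 2) `^ e)%R%:E * slab_integral (t + t * r)%R t))%E).
    have mGt : measurable_fun setT (fun r : R => slab_integral (t + t * r)%R t).
      by apply: (measurableT_comp mG (g := fun r : R => (t + t * r, t)));
        measurability.
    by measurability.
  have q0 : 0 <= sphere_area k / sphere_area k.+1 :> R.
    by rewrite divr_ge0// sphere_area_ge0.
  rewrite -(ge0_integralZl _ _ mK)//.
  - apply: eq_integral => r _; rewrite muleA -EFinM kernel_scale//.
    move: (sphere_area k / _) q0 => q _.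
    by rewrite (addrC (t * r)) !EFinM -!muleA muleCA.
  - move=> r _; rewrite mule_ge0// mule_ge0 ?slab_integral_ge0//.
    by rewrite lee_fin powR_ge0.
rewrite mul0e; apply: integral0_eq => s _; rewrite /H.
(* For t <= 0 the conditions s > 0 and t > s / 2 are incompatible, so the kernel vanishes. *)
have tle : t <= 0.
  by rewrite leNgt; apply: contra tN => t0; rewrite inE/= in_itv/= t0.
have [s0|s0] := ltP 0 s.
  rewrite (_ : \1_`]0%R, +oo[ (t - s / 2) = 0) ?mulr0 ?mul0r ?mul0e//.
  by rewrite indicE memNset//= in_itv/= andbT; apply/negP; rewrite -leNgt; lra.
rewrite (_ : \1_`]0%R, +oo[ s = 0) ?mul0r ?mul0e// indicE memNset//=.
by rewrite in_itv/= andbT; apply/negP; rewrite -leNgt.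
Qed.

End reduced_integral.

(** * The left-hand side for nonnegative Borel integrands *)

Section lhs_reduction.
Context {R : realType} (m k : nat).
Variable F : 'rV[R]_m * R -> R -> R.
Hypothesis mF : measurable_fun setT (fun p : ('rV[R]_m * R) * R => F p.1 p.2).
Hypothesis F0 : forall y t, 0 <= F y t.

Let ball_indic (y : 'rV[R]_k.+1 * R) : R := \1_punctured_ball y.

Let mball : measurable_fun setT ball_indic.
Proof. exact: (@measurable_indic _ _ R setT _ (@measurable_punctured_ball R k.+1)). Qed.

Let shift (B : 'M[R]_(k.+1, m)) (x : 'rV[R]_m * R) (y : 'rV[R]_k.+1 * R) :
    'rV[R]_m * R :=
  (x.1 + x.2 *: (sphere_chart B y).1, x.2 + x.2 * (sphere_chart B y).2).

(** The transform [J] as an integral over a domain independent of xi. With [selected_basis] in place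
    of B it is measurable in (x, xi) jointly, on the whole space. *)
Let cone_J (B : 'M[R]_(k.+1, m)) (x : 'rV[R]_m * R) : \bar R :=
  ((sphere_area k.+1)^-1%:E * (k.+2%:R%:E * \int[lebesgue_rVR k.+1]_y
    ((ball_indic y)%:E * (F (shift B x y) x.2)%:E)))%E.

Let integrand0 B x y : (0 <= (ball_indic y)%:E * (F (shift B x y) x.2)%:E)%E.
Proof. by rewrite mule_ge0// lee_fin. Qed.

Let mintegrand : measurable_fun setT
  (fun q : (('rV[R]_m * R) * lin_subspace R m) * ('rV[R]_k.+1 * R) =>
    (ball_indic q.2)%:E *
    (F (shift (selected_basis k.+1 q.1.2) q.1.1 q.2) q.1.1.2)%:E)%E.
Proof.
have mb := mball; have me := @measurable_enorm R k.+1.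
have ms := @measurable_selected_basis R m k.+1.
apply: emeasurable_funM; apply/measurable_EFinP; first by measurability.
apply: (measurableT_comp mF (g := fun q => (_, _))); rewrite /shift /sphere_chart.
by measurability.
Qed.

Lemma J_selected_basis (x : 'rV[R]_m * R) (xi : lin_subspace R m) :
  grassmannian k.+1 xi ->
  J k.+1 (F ^~ x.2) x xi = cone_J (selected_basis k.+1 xi) x.
Proof.
move=> dk; rewrite /J /cone_J; congr (_ * _)%E.
apply: (ge0_integral_subsphere (F := fun theta =>
  (F (x.1 + x.2 *: theta.1, x.2 + x.2 * theta.2)%R x.2)%:E) dk).
- exact: selected_basisP.
- apply/measurable_EFinP.
  apply: (measurableT_comp mF (g := fun theta : 'rV[R]_m * R =>
    ((x.1 + x.2 *: theta.1, x.2 + x.2 * theta.2), x.2))).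
  by measurability.
- by move=> theta; rewrite lee_fin.
Qed.

Lemma measurable_cone_J : measurable_fun setT
  (fun p : ('rV[R]_m * R) * lin_subspace R m =>
    cone_J (selected_basis k.+1 p.2) p.1).
Proof.
rewrite /cone_J; apply: emeasurable_funM; first exact: measurable_cst.
apply: emeasurable_funM; first exact: measurable_cst.
exact: (@measurable_fun_integral _ _ _ _ _ (lebesgue_rVR k.+1)
  (fun p y => _) mintegrand (fun p y => integrand0 _ _ _)).
Qed.

Lemma cone_J_ge0 B x : (0 <= cone_J B x)%E.
Proof.
rewrite /cone_J mule_ge0 ?lee_fin ?invr_ge0 ?sphere_area_ge0//.
by rewrite mule_ge0// ?lee_fin//; apply: integral_ge0.
Qed.

Lemma measurable_half_space : measurable (@half_space R m).
Proof.
have -> : @half_space R m = snd @^-1` `]0, +oo[%classic.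
  by apply/seteqP; split => x; rewrite /half_space/= in_itv/= andbT.
rewrite -[X in measurable X]setTI; apply: measurable_snd => //.
Qed.

Lemma measurable_domain :
  measurable (@half_space R m `*` @grassmannian R m k.+1).
Proof.
apply: measurableX; first exact: measurable_half_space.
exact: measurable_grassmannian.
Qed.

Lemma measurable_J :
  measurable_fun (@half_space R m `*` @grassmannian R m k.+1)
    (fun p => J k.+1 (F ^~ p.1.2) p.1 p.2).
Proof.
have := measurable_funTS measurable_cone_J
  (D := @half_space R m `*` @grassmannian R m k.+1).
by apply: eq_measurable_fun => p; rewrite inE => -[_ pG]; rewrite J_selected_basis.
Qed.

(** For fixed height t and fixed y, translating x' by the horizontal part of t theta removes the
    basis. The remaining integrand depends on y through y_n / |y| only, and [ge0_integral_slice]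
    applies. *)
Let integral_cone_J (xi : lin_subspace R m) :
  (\int[lebesgue_rVR m]_x ((\1_(@half_space R m) x)%:E *
     cone_J (selected_basis k.+1 xi) x) = reduced_integral k F)%E.
Proof.
set B := selected_basis k.+1 xi.
have mh := @measurable_indic _ _ R setT _ measurable_half_space.
have mJ : measurable_fun setT (cone_J B).
  by apply: (measurableT_comp measurable_cone_J (g := fun x => (x, xi)));
    measurability.
have mhJ : measurable_fun setT (fun x => (\1_(@half_space R m) x)%:E * cone_J B x)%E.
  by measurability.
have hJ0 x : (0 <= (\1_(@half_space R m) x)%:E * cone_J B x)%E.
  by rewrite mule_ge0// cone_J_ge0.
rewrite (ge0_integral_rVR_swap mhJ hJ0) /reduced_integral.
apply: eq_integral => t _.
have hE x : \1_(@half_space R m) (x, t) = \1_`]0%R, +oo[ t :> R.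
  rewrite !indicE; congr (nat_of_bool _)%:R; apply/idP/idP;
    by rewrite !inE/= in_itv/= andbT.
under eq_integral do rewrite hE.
have s0 : (0 <= ((sphere_area k.+1)^-1 : R)%:E)%E.
  by rewrite lee_fin invr_ge0 sphere_area_ge0.
have mint : measurable_fun setT (fun q : 'rV[R]_m * ('rV[R]_k.+1 * R) =>
    (ball_indic q.2)%:E * (F (shift B (q.1, t) q.2) t)%:E)%E.
  by apply: (measurableT_comp mintegrand (g := fun q : 'rV[R]_m * _ =>
    (((q.1, t), xi), q.2))); measurability.
have int0 (x : 'rV[R]_m) y :
    (0 <= (ball_indic y)%:E * (F (shift B (x, t) y) t)%:E)%E.
  by rewrite mule_ge0// lee_fin.
have mJt : measurable_fun setT (fun x : 'rV[R]_m => cone_J B (x, t)).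
  by apply: (measurableT_comp mJ (g := fun x => (x, t))); measurability.
transitivity ((\1_`]0%R, +oo[ t)%:E *
    \int[lebesgue_rV m]_x cone_J B (x, t))%E.
  by rewrite -(ge0_integralZl _ _ mJt)// => x _; exact: cone_J_ge0.
congr (_ * _)%E; rewrite /cone_J.
have mi : measurable_fun setT (fun x : 'rV[R]_m => \int[lebesgue_rVR k.+1]_y
    ((ball_indic y)%:E * (F (shift B (x, t) y) t)%:E))%E.
  exact: (@measurable_fun_integral _ _ _ _ _ (lebesgue_rVR k.+1)
    (fun x y => _) mint int0).
have i0 (x : 'rV[R]_m) : (0 <= \int[lebesgue_rVR k.+1]_y
    ((ball_indic y)%:E * (F (shift B (x, t) y) t)%:E))%E.
  exact: integral_ge0.
transitivity (((sphere_area k.+1)^-1)%:E * (k.+2%:R%:E *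
    \int[lebesgue_rV m]_x \int[lebesgue_rVR k.+1]_y
      ((ball_indic y)%:E * (F (shift B (x, t) y) t)%:E)))%E.
  have mki : measurable_fun setT (fun x : 'rV[R]_m =>
      k.+2%:R%:E * \int[lebesgue_rVR k.+1]_y
      ((ball_indic y)%:E * (F (shift B (x, t) y) t)%:E))%E by measurability.
  rewrite -(ge0_integralZl _ _ mi)// -(ge0_integralZl _ _ mki)// => x _.
  by rewrite mule_ge0// lee_fin.
have mG := measurable_slab_integral mF F0.
transitivity (((sphere_area k.+1)^-1)%:E * (k.+2%:R%:E *
    \int[lebesgue_rVR k.+1]_y ((ball_indic y)%:E *
       slab_integral F (t + t * (y.2 / enorm y)) t)))%E.
  congr (_ * (_ * _))%E.
  transitivity (\int[lebesgue_rVR k.+1]_y \int[lebesgue_rV m]_x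
      ((ball_indic y)%:E * (F (shift B (x, t) y) t)%:E))%E.
    exact: (ge0_integral_exchange _ _ mint int0).
  apply: eq_integral => y _.
  have mFs s : measurable_fun setT (fun x : 'rV[R]_m => (F (x, s) t)%:E).
    apply/measurable_EFinP.
    by apply: (measurableT_comp mF (g := fun x : 'rV[R]_m => ((x, s), t)));
      measurability.
  have Fs0 s (x : 'rV[R]_m) : (0 <= (F (x, s) t)%:E)%E by rewrite lee_fin.
  rewrite /slab_integral.
  rewrite -(ge0_integral_rV_translation (t *: (sphere_chart B y).1) (mFs _) (Fs0 _)).
  have b0 : (0 <= (ball_indic y)%:E)%E by rewrite lee_fin.
  have mFa : measurable_fun setT (fun x : 'rV[R]_m =>
      (F (x + t *: (sphere_chart B y).1, t + t * (y.2 / enorm y)) t)%:E).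
    by apply: (measurableT_comp (mFs _)); measurability.
  rewrite -(ge0_integralZl _ _ mFa)//.
  by apply: eq_integral => x _; rewrite /shift/= (mulrC (enorm y)^-1).
have mh' : measurable_fun setT (fun r : R => slab_integral F (t + t * r)%R t).
  have mp : measurable_fun setT (fun r : R => (t + t * r, t) : R * R).
    by measurability.
  exact: (measurableT_comp mG mp).
transitivity (((sphere_area k.+1)^-1)%:E * ((sphere_area k)%:E *
    \int[leb]_r ((\1_`]-1, 1[ r)%:E *
     (((1 - r ^+ 2) `^ ((k.+1%:R - 2) / 2))%:E *
       slab_integral F (t + t * r)%R t))))%E.
  congr (_ * _)%E.
  exact: (@ge0_integral_slice R k _ mh' (fun r => slab_integral_ge0 F0 _ _)).
by rewrite muleA -EFinM mulrC.
Qed.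

Lemma lhs_integralE (nu : probability (lin_subspace R m) R) :
  nu (@grassmannian R m k.+1) = 1%E ->
  lhs_integral k.+1 nu F = reduced_integral k F.
Proof.
move=> nu1; rewrite /lhs_integral integral_indicl.
have mD := @measurable_indic _ _ R setT _ measurable_domain.
have mJ := measurable_cone_J.
have mDJ : measurable_fun setT (fun p : ('rV[R]_m * R) * lin_subspace R m =>
    (\1_(@half_space R m `*` @grassmannian R m k.+1) p)%:E *
    cone_J (selected_basis k.+1 p.2) p.1)%E by measurability.
have DJ0 p : (0 <= (\1_(@half_space R m `*` @grassmannian R m k.+1) p)%:E *
    cone_J (selected_basis k.+1 p.2) p.1)%E by rewrite mule_ge0// cone_J_ge0.
transitivity (\int[(lebesgue_rVR m \x nu)%E]_p
    ((\1_(@half_space R m `*` @grassmannian R m k.+1) p)%:E *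
    cone_J (selected_basis k.+1 p.2) p.1))%E.
  apply: eq_integral => -[x xi] _; rewrite indicE.
  case: (boolP (_ \in _)) => [|_]; last by rewrite !mul0e.
  by rewrite inE => -[_ /= gxi]; rewrite J_selected_basis.
transitivity (\int[nu]_xi ((\1_(@grassmannian R m k.+1) xi)%:E * reduced_integral k F))%E.
  rewrite (@fubini_tonelli2 _ _ _ _ _ (lebesgue_rVR m) nu _ mDJ DJ0).
  apply: eq_integral => xi _; rewrite /fubini_G/= indicE.
  case: (boolP (xi \in _)) => [xiG|xiG].
    rewrite mul1e -(integral_cone_J xi); apply: eq_integral => x _.
    by rewrite !indicE in_setX/= xiG andbT.
  rewrite mul0e; apply: integral0_eq => x _.
  by rewrite indicE in_setX/= (negbTE xiG) andbF mul0e.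
(* The sign of the constant is read off from its expression by [cone_J] at an arbitrary subspace. *)
have r0 : (0 <= reduced_integral k F)%E.
  rewrite -(integral_cone_J point); apply: integral_ge0 => x _.
  by rewrite mule_ge0// cone_J_ge0.
have mG := @measurable_grassmannian R m k.+1.
have miG : measurable_fun setT (fun xi : lin_subspace R m =>
    (\1_(@grassmannian R m k.+1) xi : R)%:E).
  by have := @measurable_indic _ _ R setT _ mG => ?; measurability.
rewrite ge0_integralZr//.
transitivity (nu (@grassmannian R m k.+1) * reduced_integral k F)%E.
  by congr (_ * _)%E; rewrite integral_indic// setIT.
by rewrite nu1 mul1e.
Qed.

Lemma lhs_integral_rhs (nu : probability (lin_subspace R m) R) :
  nu (@grassmannian R m k.+1) = 1%E ->
  lhs_integral k.+1 nu F = rhs_integral k.+1 F.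
Proof. by move=> nu1; rewrite lhs_integralE// rhs_integralE. Qed.

End lhs_reduction.

(** * Differences of possibly infinite integrals *)

Lemma maxe_balance (R : realType) (a b : \bar R) : (0 <= a)%E -> (0 <= b)%E ->
  (maxe (a - b) 0 + b = maxe (- (a - b)) 0 + a)%E.
Proof.
case: a => [a| |]; case: b => [b| |] // a0 b0.
- rewrite -EFinB -EFinN -!EFin_max -!EFinD; congr (_%:E).
  by case: (leP (a - b) 0); case: (leP (- (a - b)) 0); lra.
- by rewrite [X in (maxe X _ + _)%E](_ : _ = -oo%E)// maxNye maxye add0e.
- by rewrite [X in (maxe X _ + _)%E](_ : _ = +oo%E)// maxNye maxye add0e.
- by rewrite maxNye maxye add0e.
Qed.

Lemma maxe_subB_le (R : realType) (a b : \bar R) : (0 <= a)%E -> (0 <= b)%E ->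
  (maxe (a - b) 0 <= a)%E.
Proof.
case: a => [a| |]; case: b => [b| |] // a0 b0; try exact: leey.
  rewrite -EFinB -EFin_max lee_fin; rewrite !lee_fin in a0 b0.
  by case: (leP (a - b) 0); lra.
by rewrite [X in (maxe X _)%E](_ : _ = -oo%E)// maxNye.
Qed.

Lemma maxe_negB_le (R : realType) (a b : \bar R) : (0 <= a)%E -> (0 <= b)%E ->
  (maxe (- (a - b)) 0 <= b)%E.
Proof.
case: a => [a| |]; case: b => [b| |] // a0 b0; try exact: leey.
  rewrite -EFinB -EFinN -EFin_max lee_fin; rewrite !lee_fin in a0 b0.
  by case: (leP (- (a - b)) 0); lra.
by rewrite [X in (maxe X _)%E](_ : _ = -oo%E)// maxNye.
Qed.

(** The bounds p <= a and q <= b pass finiteness from a or b to p or q, after which the balance can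
    be rearranged. *)
Lemma sube_balance (R : realType) (a b p q : \bar R) : (p + b = q + a)%E ->
  (q <= b)%E -> (p <= a)%E -> (0 <= a)%E -> (0 <= b)%E -> (0 <= p)%E ->
  (0 <= q)%E -> (a < +oo)%E \/ (b < +oo)%E -> (p - q = a - b)%E.
Proof.
move=> E qb pa a0 b0 p0 q0 [fin|fin].
- have pfin := le_lt_trans pa fin.
  move: E; rewrite -(fineK (_ : a \is a fin_num)) ?ge0_fin_numE//.
  rewrite -(fineK (_ : p \is a fin_num)) ?ge0_fin_numE//.
  case: q q0 qb => [q| |] // _ _; case: b b0 => [b| |] // _.
  rewrite -!EFinD => -[E]; rewrite -[LHS]EFinB -[RHS]EFinB.
  by congr (_%:E); lra.
- have qfin := le_lt_trans qb fin.
  move: E; rewrite -(fineK (_ : b \is a fin_num)) ?ge0_fin_numE//.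
  rewrite -(fineK (_ : q \is a fin_num)) ?ge0_fin_numE//.
  case: p p0 pa => [p| |] // _ _; case: a a0 => [a| |] // _.
  rewrite -!EFinD => -[E]; rewrite -[LHS]EFinB -[RHS]EFinB.
  by congr (_%:E); lra.
Qed.

Lemma scaled_sube (R : realType) (r : R) (a b : \bar R) : 0 <= r ->
  (0 <= a)%E -> (0 <= b)%E ->
  (r%:E * a < +oo)%E \/ (r%:E * b < +oo)%E ->
  (r%:E * (a - b) = r%:E * a - r%:E * b)%E.
Proof.
rewrite le_eqVlt => /predU1P[<-|r0] a0 b0; first by rewrite !mul0e sube0.
have fin x : (0 <= x)%E -> (r%:E * x < +oo)%E -> x \is a fin_num.
  case: x => [x| |] //; by rewrite gt0_muley.
move=> [/fin|/fin] => [/(_ a0) af|/(_ b0) bf]; rewrite muleBr//.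
  by rewrite fin_num_adde_defr.
by rewrite fin_num_adde_defl// fin_numN.
Qed.

(** The excluded case is a = b = +oo, where both differences are -oo by convention. *)
Lemma oppe_sube (R : realType) (a b : \bar R) : (0 <= a)%E -> (0 <= b)%E ->
  (a < +oo)%E \/ (b < +oo)%E -> (a - b = - (b - a))%E.
Proof.
case: a => [a| |]; case: b => [b| |] // _ _ [] // _.
  by rewrite -!EFinB -EFinN opprB.
by rewrite -!EFinB -EFinN opprB.
Qed.

Section integral_transfer.
Context d (T : measurableType d) (R : realType).
Variable mu : {measure set T -> \bar R}.
Implicit Types D N : set T.

Import HBNNSimple.

(** A simple function below [a], set to 0 on N, lies below [b] and keeps its integral. The argument
    covers non-measurable functions, such as [J] applied to an arbitrary version of f. *)
Let ge0_le_integral_negligible N (a b : T -> \bar R) :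
  measurable N -> mu N = 0%E -> (forall x, (0 <= a x)%E) ->
  (forall x, (0 <= b x)%E) -> (forall x, ~ N x -> a x = b x) ->
  (\int[mu]_x a x <= \int[mu]_x b x)%E.
Proof.
move=> mN N0 a0 b0 ab; rewrite !ge0_integralTE//.
apply: ge_ereal_sup => _ [h /= ha <-].
have mCN : measurable (~` N) by exact: measurableC.
have -> : sintegral mu h = sintegral mu (proj_nnsfun h mCN).
  rewrite -!integralT_nnsfun; apply: ge0_ae_eq_integral => //.
  - exact/measurable_EFinP.
  - exact/measurable_EFinP.
  - by move=> x _; rewrite lee_fin.
  - by move=> x _; rewrite lee_fin.
  exists N; split => // x /= /not_implyP[_ hx]; apply: contrapT => Nx; apply: hx.
  by rewrite /= mindicE mem_set// mulr1.
apply: ereal_sup_ubound; exists (proj_nnsfun h mCN) => //= x.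
rewrite mindicE; case: (boolP (x \in ~` N)) => [|_]; last by rewrite mulr0.
by rewrite inE mulr1 => Nx; rewrite -ab.
Qed.

Lemma integral_negligible_eq D (f g : T -> \bar R) :
  mu.-negligible [set x | D x /\ f x <> g x] ->
  (\int[mu]_(x in D) f x = \int[mu]_(x in D) g x)%E.
Proof.
move=> [N [mN N0 fgN]].
have fgE x : ~ N x -> (f \_ D) x = (g \_ D) x.
  move=> Nx; rewrite !patchE; case: ifPn => //; rewrite inE => Dx.
  by apply: contrapT => fg; apply: Nx; apply: fgN.
have posE x : ~ N x -> ((f \_ D)^\+ x = (g \_ D)^\+ x)%E.
  by move=> Nx; rewrite !funeposE fgE.
have negE x : ~ N x -> ((f \_ D)^\- x = (g \_ D)^\- x)%E.
  by move=> Nx; rewrite !funenegE fgE.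
rewrite integral_mkcond [RHS]integral_mkcond integralE [RHS]integralE.
congr (_ - _)%E; apply/eqP; rewrite eq_le; apply/andP; split;
  apply: (ge0_le_integral_negligible mN N0) => // x Nx;
  first [exact: posE | exact: negE | exact/esym/posE | exact/esym/negE].
Qed.

(** Since one of the integrals may be infinite, the identity (P - Q)^+ + Q = (P - Q)^- + P is
    integrated instead, and rearranged afterwards. *)
Lemma ge0_integralB D (P Q : T -> \bar R) : measurable D ->
  measurable_fun D P -> measurable_fun D Q ->
  (forall x, D x -> (0 <= P x)%E) -> (forall x, D x -> (0 <= Q x)%E) ->
  (\int[mu]_(x in D) P x < +oo)%E \/ (\int[mu]_(x in D) Q x < +oo)%E ->
  (\int[mu]_(x in D) (P x - Q x) =
   \int[mu]_(x in D) P x - \int[mu]_(x in D) Q x)%E.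
Proof.
move=> mD mP mQ P0 Q0 fin.
pose h x := (P x - Q x)%E.
have mh : measurable_fun D h by exact: emeasurable_funB.
have mhp : measurable_fun D (h ^\+)%E by exact: measurable_funepos.
have mhn : measurable_fun D (h ^\-)%E by exact: measurable_funeneg.
have balance : (\int[mu]_(x in D) (h ^\+)%E x + \int[mu]_(x in D) Q x =
    \int[mu]_(x in D) (h ^\-)%E x + \int[mu]_(x in D) P x)%E.
  rewrite -!ge0_integralD//; apply: eq_integral => x; rewrite inE => Dx.
  by rewrite funeposE funenegE; apply: maxe_balance; [exact: P0|exact: Q0].
have hnQ : (\int[mu]_(x in D) (h ^\-)%E x <= \int[mu]_(x in D) Q x)%E.
  apply: ge0_le_integral => //.
  by move=> y Dy; rewrite funenegE; apply: maxe_negB_le; [exact: P0|exact: Q0].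
have hpP : (\int[mu]_(x in D) (h ^\+)%E x <= \int[mu]_(x in D) P x)%E.
  apply: ge0_le_integral => //.
  by move=> y Dy; rewrite funeposE; apply: maxe_subB_le; [exact: P0|exact: Q0].
have IP0 : (0 <= \int[mu]_(x in D) P x)%E by exact: integral_ge0.
have IQ0 : (0 <= \int[mu]_(x in D) Q x)%E by exact: integral_ge0.
have Ip0 : (0 <= \int[mu]_(x in D) (h ^\+)%E x)%E by exact: integral_ge0.
have In0 : (0 <= \int[mu]_(x in D) (h ^\-)%E x)%E by exact: integral_ge0.
rewrite integralE.
exact: (sube_balance balance hnQ hpP IP0 IQ0 Ip0 In0 fin).
Qed.

(** Brings a scalar of either sign, u (x_n) for [J] or f x for [v], under the inner integral. For w
    < 0 the positive part of a w is |w| times the negative part of a. *)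
Lemma integral_signed_scale D (a : T -> R) (c w : R) : measurable D ->
  measurable_fun D a -> 0 <= c ->
  let p := (c%:E * \int[mu]_(x in D) (Num.max (a x * w) 0)%:E)%E in
  let q := (c%:E * \int[mu]_(x in D) (Num.max (- (a x * w)) 0)%:E)%E in
  (p < +oo)%E \/ (q < +oo)%E ->
  ((c%:E * \int[mu]_(x in D) (a x)%:E) * w%:E = p - q)%E.
Proof.
move=> mD ma c0 p q.
pose A := (\int[mu]_(x in D) (Num.max (a x) 0)%:E)%E.
pose B := (\int[mu]_(x in D) (Num.max (- a x) 0)%:E)%E.
have A0 : (0 <= A)%E by apply: integral_ge0 => x _; rewrite lee_fin le_max lexx orbT.
have B0 : (0 <= B)%E by apply: integral_ge0 => x _; rewrite lee_fin le_max lexx orbT.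
have -> : (\int[mu]_(x in D) (a x)%:E = A - B)%E.
  rewrite integralE; congr (_ - _)%E; apply: eq_integral => x _.
    by rewrite funeposE -EFin_max.
  by rewrite funenegE -EFinN -EFin_max.
have mA : measurable_fun D (fun x => (Num.max (a x) 0)%:E).
  by apply/measurable_EFinP; apply: measurable_maxr.
have mB : measurable_fun D (fun x => (Num.max (- a x) 0)%:E).
  by apply/measurable_EFinP; apply: measurable_maxr => //; exact: measurable_funN.
have scale (r : R) (b : T -> R) : 0 <= r ->
    measurable_fun D (fun x => (Num.max (b x) 0)%:E) ->
    (\int[mu]_(x in D) (Num.max (b x * r) 0)%:E =
     r%:E * \int[mu]_(x in D) (Num.max (b x) 0)%:E)%E.
  move=> r0 mb; rewrite -ge0_integralZl//.
  - apply: eq_integral => x _; rewrite -EFinM; congr (_%:E).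
    by rewrite maxr_pMr// mulr0 mulrC.
  - by move=> x _; rewrite lee_fin le_max lexx orbT.
have [w0|w0] := leP 0 w.
- have pE : p = ((c * w)%:E * A)%E by rewrite /p scale// EFinM muleA.
  have qE : q = ((c * w)%:E * B)%E.
    rewrite EFinM -muleA -(scale w (fun x => - a x) w0 mB); congr (_ * _)%E.
    by apply: eq_integral => x _; rewrite mulNr.
  by rewrite pE qE muleAC -EFinM; exact: scaled_sube (mulr_ge0 c0 w0) A0 B0.
- have w0' : 0 <= - w by rewrite oppr_ge0 ltW.
  have pE : p = ((c * - w)%:E * B)%E.
    rewrite EFinM -muleA -(scale (- w) (fun x => - a x) w0' mB); congr (_ * _)%E.
    by apply: eq_integral => x _; rewrite mulrNN.
  have qE : q = ((c * - w)%:E * A)%E.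
    rewrite EFinM -muleA -(scale (- w) a w0' mA); congr (_ * _)%E.
    by apply: eq_integral => x _; rewrite mulrN.
  rewrite pE qE => fin.
  rewrite -(scaled_sube (mulr_ge0 c0 w0') B0 A0 fin) mulrN EFinN mulNe -muleN.
  rewrite muleAC -EFinM.
  (* Finiteness of [p] or [q] yields that of [A] or [B] only when c w is nonzero. *)
  have [->|cw0] := eqVneq (c * w) 0; first by rewrite !mul0e.
  congr (_ * _)%E; apply: oppe_sube => //.
  have cw : 0 < c * - w by rewrite lt_def mulrN oppr_eq0 cw0 -mulrN mulr_ge0.
  have finE x : (0 <= x)%E -> ((c * - w)%:E * x < +oo)%E -> (x < +oo)%E.
    by case: x => [x| |] // _; rewrite ?ltry// gt0_muley.
  by case: fin => [/(finE _ B0)|/(finE _ A0)]; [right|left].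
Qed.

End integral_transfer.

Lemma negligible_integral_infty d (T : measurableType d) (R : realType)
    (mu : {measure set T -> \bar R}) (D : set T) (P : T -> \bar R) :
  measurable D -> measurable_fun D P -> (forall x, D x -> (0 <= P x)%E) ->
  (\int[mu]_(x in D) P x < +oo)%E ->
  mu.-negligible [set x | D x /\ ~ (P x < +oo)%E].
Proof.
move=> mD mP P0 Pfin.
have Pint : mu.-integrable D P.
  apply/integrableP; split => //; rewrite (eq_integral P)// => x.
  by rewrite inE => Dx; rewrite gee0_abs// P0.
have := integrable_ae mD Pint; apply: negligibleS => x /= [Dx Px] h.
by apply: Px; rewrite -ge0_fin_numE ?P0// h.
Qed.

(** * Signed Borel functions *)

Section borel_duality.
Context {R : realType} (m k : nat) (nu : probability (lin_subspace R m) R).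
Variables (f : 'rV[R]_m * R -> R) (u : R -> R).
Hypotheses (mf : measurable_fun setT f) (mu : measurable_fun setT u).

Definition product_pos (y : 'rV[R]_m * R) (t : R) : R := Num.max (f y * u t) 0.
Definition product_neg (y : 'rV[R]_m * R) (t : R) : R :=
  Num.max (- (f y * u t)) 0.

Lemma measurable_product_pos :
  measurable_fun setT (fun p : ('rV[R]_m * R) * R => product_pos p.1 p.2).
Proof. by apply: measurable_maxr; measurability. Qed.

Lemma measurable_product_neg :
  measurable_fun setT (fun p : ('rV[R]_m * R) * R => product_neg p.1 p.2).
Proof. by apply: measurable_maxr; measurability. Qed.

Lemma product_pos_ge0 y t : 0 <= product_pos y t.
Proof. by rewrite le_max lexx orbT. Qed.

Lemma product_neg_ge0 y t : 0 <= product_neg y t.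
Proof. by rewrite le_max lexx orbT. Qed.

Lemma J_ge0 (F : 'rV[R]_m * R -> R) x (xi : lin_subspace R m) :
  (forall y, 0 <= F y) -> (0 <= J k.+1 F x xi)%E.
Proof.
move=> F0; rewrite /J mule_ge0 ?lee_fin ?invr_ge0 ?sphere_area_ge0//.
by apply: integral_ge0 => theta _; rewrite lee_fin.
Qed.

Let D := @half_space R m `*` @grassmannian R m k.+1.

(** If the integral of [P] or of [Q] is finite, that function is finite almost everywhere, and at
    such points J f * u is the difference P - Q. *)
Lemma borel_lhs :
  (lhs_integral k.+1 nu product_pos < +oo)%E \/
  (lhs_integral k.+1 nu product_neg < +oo)%E ->
  (\int[(lebesgue_rVR m \x nu)%E]_(p in D) (J k.+1 f p.1 p.2 * (u p.1.2)%:E) =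
   lhs_integral k.+1 nu product_pos - lhs_integral k.+1 nu product_neg)%E.
Proof.
pose P p := J k.+1 (product_pos ^~ p.1.2) p.1 p.2.
pose Q p := J k.+1 (product_neg ^~ p.1.2) p.1 p.2.
have mD : measurable D by exact: measurable_domain.
have mP : measurable_fun D P.
  exact: (@measurable_J R m k _ measurable_product_pos product_pos_ge0).
have mQ : measurable_fun D Q.
  exact: (@measurable_J R m k _ measurable_product_neg product_neg_ge0).
have P0 p : D p -> (0 <= P p)%E.
  by move=> _; apply: J_ge0 => y; exact: product_pos_ge0.
have Q0 p : D p -> (0 <= Q p)%E.
  by move=> _; apply: J_ge0 => y; exact: product_neg_ge0.
move=> fin.
rewrite -[RHS](ge0_integralB mD mP mQ P0 Q0 fin).
apply: integral_negligible_eq.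
have scale p : D p -> (P p < +oo)%E \/ (Q p < +oo)%E ->
    (J k.+1 f p.1 p.2 * (u p.1.2)%:E = P p - Q p)%E.
  move=> Dp; apply: integral_signed_scale.
  - exact: measurable_subsphere.
  - have mg : measurable_fun setT (fun theta : 'rV[R]_m * R =>
        (p.1.1 + p.1.2 *: theta.1, p.1.2 + p.1.2 * theta.2)).
      by measurability.
    by apply: measurable_funTS; exact: (measurableT_comp mf mg).
  - by rewrite invr_ge0 sphere_area_ge0.
case: fin => [Pfin|Qfin].
- apply: negligibleS (negligible_integral_infty mD mP P0 Pfin).
  by move=> p [Dp h]; split => // Pp; apply: h; apply: scale => //; left.
- apply: negligibleS (negligible_integral_infty mD mQ Q0 Qfin).
  by move=> p [Dp h]; split => // Qp; apply: h; apply: scale => //; right.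
Qed.

Lemma borel_rhs :
  (rhs_integral k.+1 product_pos < +oo)%E \/
  (rhs_integral k.+1 product_neg < +oo)%E ->
  (\int[lebesgue_rVR m]_(x in half_space m) ((f x)%:E * v k.+1 u x.2) =
   rhs_integral k.+1 product_pos - rhs_integral k.+1 product_neg)%E.
Proof.
pose P (x : 'rV[R]_m * R) := v k.+1 (product_pos x) x.2.
pose Q (x : 'rV[R]_m * R) := v k.+1 (product_neg x) x.2.
have mD := @measurable_half_space R m.
have mP : measurable_fun (@half_space R m) P.
  exact: (@measurable_v R m k _ measurable_product_pos product_pos_ge0).
have mQ : measurable_fun (@half_space R m) Q.
  exact: (@measurable_v R m k _ measurable_product_neg product_neg_ge0).
have P0 x : half_space m x -> (0 <= P x)%E.
  exact: (@v_ge0 R m k _ measurable_product_pos product_pos_ge0).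
have Q0 x : half_space m x -> (0 <= Q x)%E.
  exact: (@v_ge0 R m k _ measurable_product_neg product_neg_ge0).
move=> fin.
rewrite -[RHS](ge0_integralB mD mP mQ P0 Q0 fin).
apply: integral_negligible_eq.
have scale x : half_space m x -> (P x < +oo)%E \/ (Q x < +oo)%E ->
    ((f x)%:E * v k.+1 u x.2 = P x - Q x)%E.
  (* The roles are exchanged with respect to [borel_lhs]: t is the inner variable and f x the
     scalar. *)
  move=> x0; pose a t := u t * (t - x.2 / 2) `^ ((k.+1%:R - 2) / 2) / t ^+ k.
  have tpos t : t \in (`](x.2 / 2), +oo[%classic : set R) -> 0 < t.
    by rewrite inE/= in_itv/= andbT; apply: lt_trans; rewrite divr_gt0.
  have ma : measurable_fun (`](x.2 / 2), +oo[%classic : set R) a.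
    by apply: measurable_funTS; rewrite /a; measurability.
  have PE : P x = ((c_v k.+1 * x.2 `^ ((k.+1%:R - 2) / 2))%:E *
      \int[leb]_(t in `](x.2 / 2)%R, +oo[) (Num.max (a t * f x) 0)%:E)%E.
    rewrite /P /v integral_leb; congr (_ * _)%E; apply: eq_integral => t.
    move=> /tpos t0; congr (_%:E); rewrite /product_pos /a -!mulrA.
    rewrite maxr_pMl ?mul0r; last first.
      by rewrite mulr_ge0 ?powR_ge0// invr_ge0 exprn_ge0// ltW.
    by congr (Num.max _ _); ring.
  have QE : Q x = ((c_v k.+1 * x.2 `^ ((k.+1%:R - 2) / 2))%:E *
      \int[leb]_(t in `](x.2 / 2)%R, +oo[) (Num.max (- (a t * f x)) 0)%:E)%E.
    rewrite /Q /v integral_leb; congr (_ * _)%E; apply: eq_integral => t.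
    move=> /tpos t0; congr (_%:E); rewrite /product_neg /a -!mulrA.
    rewrite maxr_pMl ?mul0r; last first.
      by rewrite mulr_ge0 ?powR_ge0// invr_ge0 exprn_ge0// ltW.
    by congr (Num.max _ _); ring.
  rewrite PE QE => h; rewrite muleC /v integral_leb.
  apply: integral_signed_scale => //.
  by rewrite mulr_ge0 ?powR_ge0// c_v_ge0.
case: fin => [Pfin|Qfin].
- apply: negligibleS (negligible_integral_infty mD mP P0 Pfin).
  by move=> p [Dp h]; split => // Pp; apply: h; apply: scale => //; left.
- apply: negligibleS (negligible_integral_infty mD mQ Q0 Qfin).
  by move=> p [Dp h]; split => // Qp; apply: h; apply: scale => //; right.
Qed.

End borel_duality.

(** * Changing f and u on null sets *)

Section null_sets.
Context {R : realType} (m k : nat) (nu : probability (lin_subspace R m) R).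
Hypothesis nu1 : nu (@grassmannian R m k.+1) = 1%E.

Let D := @half_space R m `*` @grassmannian R m k.+1.
Let mu := (lebesgue_rVR m \x nu)%E.

Lemma v_negligible (M : set R) (phi phi0 : R -> R) (s : R) :
  measurable M -> leb M = 0%E -> 0 < s ->
  (forall t, 0 < t -> ~ M t -> phi t = phi0 t) ->
  v k.+1 phi s = v k.+1 phi0 s.
Proof.
move=> mM M0 s0 phiE; rewrite /v !integral_leb; congr (_ * _)%E.
apply: integral_negligible_eq; exists M; split => // t [/= ts h].
apply: contrapT => Mt; apply: h; rewrite phiE//.
move: ts; rewrite in_itv/= andbT; apply: lt_trans.
by rewrite divr_gt0.
Qed.

(* The core identity for the indicator of a null set shows that almost every
   S^k_xi, dilated and translated to x, meets the set in a null set. *)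
Lemma J_negligible (N : set ('rV[R]_m * R)) :
  measurable N -> lebesgue_rVR m N = 0%E ->
  exists2 Z, mu.-negligible Z & forall p, D p -> ~ Z p ->
    forall phi phi0 : 'rV[R]_m * R -> R,
      (forall y, half_space m y -> ~ N y -> phi y = phi0 y) ->
      J k.+1 phi p.1 p.2 = J k.+1 phi0 p.1 p.2.
Proof.
(* The point x + x_n theta leaves the half-space at theta_n = -1, where nothing is known about the
   two functions, so the complement is added to N. The integral over the half-space on the
   right-hand side does not see it. *)
move=> mN N0; pose N' := N `|` ~` half_space m.
have mN' : measurable N'.
  by apply: measurableU => //; apply: measurableC; exact: measurable_half_space.
have miN := @measurable_indic _ _ R setT _ mN'.
pose F (y : 'rV[R]_m * R) (_ : R) : R := \1_N' y.
have mF : measurable_fun setT (fun p : ('rV[R]_m * R) * R => F p.1 p.2).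
  by rewrite /F; measurability.
have F0 y t : 0 <= F y t by [].
have rhs0 : rhs_integral k.+1 F = 0%E.
  rewrite /rhs_integral -[RHS](integral0 (lebesgue_rVR m) (half_space m)).
  apply: integral_negligible_eq; exists N; split => // x [x0 /= h].
  apply: contrapT => Nx; apply: h; rewrite /v integral0_eq ?mule0// => t _.
  by rewrite /F indicE memNset ?mul0r// => -[//|]; apply.
have mD : measurable D by exact: measurable_domain.
have mJ : measurable_fun D (fun p => J k.+1 (F ^~ p.1.2) p.1 p.2).
  exact: (@measurable_J R m k _ mF F0).
have J0 p : D p -> (0 <= J k.+1 (F ^~ p.1.2) p.1 p.2)%E.
  by move=> _; apply: J_ge0.
have lhs0 : (\int[mu]_(p in D) `|J k.+1 (F ^~ p.1.2) p.1 p.2| = 0)%E.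
  rewrite -rhs0 -(lhs_integral_rhs mF F0 nu1).
  by apply: eq_integral => p; rewrite inE => Dp; rewrite gee0_abs// J0.
have /(ae_eq_integral_abs _ mD mJ) JZ := lhs0.
exists [set p | ~ (D p -> J k.+1 (F ^~ p.1.2) p.1 p.2 = 0%E)] => //.
move=> p Dp /contrapT /(_ Dp) Jp phi phi0 phiE; move: Jp; rewrite /J.
(* A zero factor would make both transforms vanish; otherwise it is the integral over the subsphere
   that is 0. *)
have [->|c0] := eqVneq ((sphere_area k.+1)^-1 : R) 0; first by rewrite !mul0e.
move=> /eqP; rewrite mule_eq0 eqe (negbTE c0)/= => /eqP I0.
congr (_ * _)%E; apply: integral_negligible_eq.
have mS := measurable_subsphere p.2.
have mg : measurable_fun setT (fun theta : 'rV[R]_m * R =>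
    (p.1.1 + p.1.2 *: theta.1, p.1.2 + p.1.2 * theta.2)).
  by measurability.
have mi : measurable_fun (subsphere p.2) (fun theta : 'rV[R]_m * R =>
    (F (p.1.1 + p.1.2 *: theta.1, p.1.2 + p.1.2 * theta.2)%R p.1.2)%:E).
  apply: measurable_funTS; apply/measurable_EFinP.
  exact: (measurableT_comp miN mg).
have I0' : (\int[subsphere_measure k.+1 p.2]_(theta in subsphere p.2)
    `|(F (p.1.1 + p.1.2 *: theta.1, p.1.2 + p.1.2 * theta.2)%R p.1.2)%:E| = 0)%E.
  by rewrite -[RHS]I0; apply: eq_integral => theta _; rewrite gee0_abs// lee_fin.
have /(ae_eq_integral_abs _ mS mi) := I0'.
apply: negligibleS => theta [Stheta h] /(_ Stheta)/= H; apply: h.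
rewrite phiE//.
- apply: contrapT => hy; case: H => /eqP; rewrite /F indicE mem_set ?oner_eq0//.
  by right.
- move=> Ny; case: H => /eqP; rewrite /F indicE mem_set ?oner_eq0//.
  by left.
Qed.

Lemma negligible_height (M : set R) : measurable M -> leb M = 0%E ->
  mu.-negligible [set p | M p.1.2].
Proof.
move=> mM M0; exists ((setT `*` M) `*` setT); split.
- by apply: measurableX => //; exact: measurableX.
- have hM : lebesgue_rVR m (setT `*` M) = 0%E.
    transitivity (lebesgue_rV m setT * leb M)%E; last by rewrite M0 mule0.
    exact: product_measure1E.
  transitivity (lebesgue_rVR m (setT `*` M) * nu setT)%E.
    by apply: product_measure1E => //; exact: measurableX.
  by rewrite hM mul0e.
- by move=> p /= Mp.
Qed.

Section versions.
Variables (f f0 : 'rV[R]_m * R -> R) (u u0 : R -> R).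
Variables (N : set ('rV[R]_m * R)) (M : set R).
Hypotheses (mN : measurable N) (N0 : lebesgue_rVR m N = 0%E).
Hypotheses (mM : measurable M) (M0 : leb M = 0%E).
Hypothesis fE : forall y, half_space m y -> ~ N y -> f y = f0 y.
Hypothesis uE : forall t, 0 < t -> ~ M t -> u t = u0 t.

(** [psi] will be the positive or the negative part. At fixed x the factor u (x_n) is a constant, so
    [J_negligible] applies to y |-> psi (f y * u x_n). *)
Lemma lhs_integral_version (psi : R -> R) :
  lhs_integral k.+1 nu (fun y t => psi (f y * u t)) =
  lhs_integral k.+1 nu (fun y t => psi (f0 y * u0 t)).
Proof.
have [Z Z0 JZ] := J_negligible mN N0.
apply: integral_negligible_eq.
apply: negligibleS (negligibleU Z0 (negligible_height mM M0)).
move=> p [Dp h]; apply: contrapT => /not_orP[Zp Mp]; apply: h.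
apply: JZ => // y y0 Ny; rewrite fE// uE//.
by case: Dp => -[].
Qed.

Lemma rhs_integral_version (psi : R -> R) :
  rhs_integral k.+1 (fun y t => psi (f y * u t)) =
  rhs_integral k.+1 (fun y t => psi (f0 y * u0 t)).
Proof.
apply: integral_negligible_eq; exists N; split => // x [x0 h].
apply: contrapT => Nx; apply: h.
by apply: (v_negligible mM M0) => // t t0 Mt; rewrite fE// uE.
Qed.

Lemma lhs_version :
  (\int[mu]_(p in D) (J k.+1 f p.1 p.2 * (u p.1.2)%:E) =
   \int[mu]_(p in D) (J k.+1 f0 p.1 p.2 * (u0 p.1.2)%:E))%E.
Proof.
have [Z Z0 JZ] := J_negligible mN N0.
apply: integral_negligible_eq.
apply: negligibleS (negligibleU Z0 (negligible_height mM M0)).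
move=> p [Dp h]; apply: contrapT => /not_orP[Zp Mp]; apply: h.
rewrite (JZ p Dp Zp f f0 fE) uE//.
by case: Dp => -[].
Qed.

Lemma rhs_version :
  (\int[lebesgue_rVR m]_(x in half_space m) ((f x)%:E * v k.+1 u x.2) =
   \int[lebesgue_rVR m]_(x in half_space m) ((f0 x)%:E * v k.+1 u0 x.2))%E.
Proof.
apply: integral_negligible_eq; exists N; split => // x [x0 h].
apply: contrapT => Nx; apply: h.
by rewrite fE// (v_negligible mM M0 x0 uE).
Qed.

End versions.

End null_sets.

Theorem lemma7p3 (R : realType) (n k : nat) (hk : (1 <= k <= n.-1)%N)
    (nu : probability (lin_subspace R n.-1) R)
    (hnu : invariant_on_grassmannian k nu)
    (f : 'rV[R]_n.-1 * R -> R) (u : R -> R)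
    (hf : lebesgue_measurable_fun (lebesgue_rVR n.-1) (half_space n.-1) f)
    (hu : lebesgue_measurable_fun lebesgue_measure `]0, +oo[ u) :
  let F := fun y t => f y * u t in
  exists_lebesgue (lhs_integral k nu) F \/ exists_lebesgue (rhs_integral k) F ->
  [/\ exists_lebesgue (lhs_integral k nu) F,
      exists_lebesgue (rhs_integral k) F &
      (\int[lebesgue_rVR n.-1 \x nu]_(p in half_space n.-1 `*` grassmannian k)
         (J k f p.1 p.2 * (u p.1.2)%:E)
       = \int[lebesgue_rVR n.-1]_(x in half_space n.-1)
         ((f x)%:E * v k u x.2))%E].
Proof.
case: k hk hnu => // k' _ [nu1 _] F.
move: n.-1 nu nu1 f u hf hu @F => m {}nu nu1 {}f {}u.
move=> [g mg [N [mN N0 gN]]] [u' mu' [M [mM M0 uM]]] F.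
(* Extension by 0 makes the Borel versions measurable on the whole spaces. *)
pose f0 := g \_ (half_space m); pose u0 := u' \_ `]0, +oo[%classic.
have mf0 : measurable_fun setT f0.
  exact: (proj1 (measurable_restrictT g (@measurable_half_space R m)) mg).
have mu0 : measurable_fun setT u0.
  exact: (proj1 (measurable_restrictT u' (measurable_itv `]0%R, +oo[)) mu').
have fE y : half_space m y -> ~ N y -> f y = f0 y.
  move=> y0 Ny; rewrite /f0 patchE mem_set//.
  by apply: contrapT => fg; apply: Ny; apply: gN.
have uE t : 0 < t -> ~ M t -> u t = u0 t.
  move=> t0 Mt; rewrite /u0 patchE mem_set/= ?in_itv/= ?t0//.
  apply: contrapT => fg; apply: Mt; apply: uM; split => //=.
  by rewrite in_itv/= t0.
pose Fp := product_pos f0 u0; pose Fn := product_neg f0 u0.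
have coreP : lhs_integral k'.+1 nu Fp = rhs_integral k'.+1 Fp.
  apply: lhs_integral_rhs nu1; first exact: measurable_product_pos.
  exact: product_pos_ge0.
have coreN : lhs_integral k'.+1 nu Fn = rhs_integral k'.+1 Fn.
  apply: lhs_integral_rhs nu1; first exact: measurable_product_neg.
  exact: product_neg_ge0.
have lhsP : lhs_integral k'.+1 nu (fun y t => Num.max (F y t) 0) =
    rhs_integral k'.+1 Fp.
  rewrite -coreP.
  exact: (lhs_integral_version nu1 mN N0 mM M0 fE uE (fun r => Num.max r 0)).
have lhsN : lhs_integral k'.+1 nu (fun y t => Num.max (- F y t) 0) =
    rhs_integral k'.+1 Fn.
  rewrite -coreN.
  exact: (lhs_integral_version nu1 mN N0 mM M0 fE uE (fun r => Num.max (- r) 0)).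
have rhsP : rhs_integral k'.+1 (fun y t => Num.max (F y t) 0) =
    rhs_integral k'.+1 Fp.
  exact: (rhs_integral_version k' mN N0 mM M0 fE uE (fun r => Num.max r 0)).
have rhsN : rhs_integral k'.+1 (fun y t => Num.max (- F y t) 0) =
    rhs_integral k'.+1 Fn.
  exact: (rhs_integral_version k' mN N0 mM M0 fE uE (fun r => Num.max (- r) 0)).
rewrite /exists_lebesgue lhsP lhsN rhsP rhsN => fin.
(* By the nonnegative case, both existence conditions have become this same disjunction. *)
have {}fin : (rhs_integral k'.+1 Fp < +oo)%E \/ (rhs_integral k'.+1 Fn < +oo)%E.
  by case: fin.
split; [exact: fin | exact: fin | ].
apply: (etrans (lhs_version nu1 mN N0 mM M0 fE uE)).
apply: (etrans _ (esym (rhs_version k' mN N0 mM M0 fE uE))).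
have finl : (lhs_integral k'.+1 nu Fp < +oo)%E \/
    (lhs_integral k'.+1 nu Fn < +oo)%E by rewrite coreP coreN.
apply: (etrans (borel_lhs mf0 mu0 finl)).
by rewrite -/Fp -/Fn coreP coreN; exact: (esym (borel_rhs mf0 mu0 fin)).
Qed.
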